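(* Let $\mathscr B$ be a uniformly convex family of Banach spaces which is closed under taking ultraproducts, and let $X$ be a separated disjoint union of finite spaces with bounded geometry such that $X$ is monogenic. Then the following are equivalent: (1) $X$ has uniform geometric property $(T_{\mathscr B})$; (2) there exists an idempotent $p\in C_{\mathscr B,\max}(X)$ such that for every representation $\pi:\mathbb C_u[X]\to\mathcal L(B)$ with $B\in\mathscr B$, the operator $\pi(p)$ is the idempotent onto the invariant subspace $B^\pi$ along the annihilator space $B_\pi$.
   Context: An extended metric space $(X,d)$ (values in $[0,\infty]$) has bounded geometry if $\sup_{x}\#B(x,R)<\infty$ for all $R>0$. Put $\Delta_R=\{(x,y):d(x,y)\le R\}$; an entourage is a subset of some $\Delta_R$; $E\circ F=\{(x,y):\exists z,\ (x,z)\in E,\ (z,y)\in F\}$ and $E^{\circ n}$ is the $n$-fold composition. $X$ is monogenic if some entourage $E$ is generating, i.e. every entourage is contained in some $E^{\circ n}$; $E_0$ denotes a fixed symmetric generating entourage. A separated disjoint union of $(X_n)$ is $\bigsqcup_n X_n$ with the given metric on each $X_n$ and $d(X_n,X_m)=\infty$ for $n\neq m$ (countably many pieces). $\mathbb C_u[X]$ is the algebra of complex matrices $T=(T_{xy})_{x,y\in X}$ with uniformly bounded entries whose support $\mathrm{supp}(T)=\{(x,y):T_{xy}\ne 0\}$ is an entourage; $\ell^\infty(X)$ is the subalgebra of diagonal matrices; $T^*$ is the conjugate transpose. A partial translation is $V\in\mathbb C_u[X]$ with entries in $\{0,1\}$ and at most one nonzero entry in each row and each column; $R_V=\{x:\exists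 y,\ V_{xy}=1\}$. $\|T\|_{\ell^1}=\inf\{\sum_{i=1}^N\|f_i\|_\infty : T=\sum_{i=1}^N f_iV_i,\ f_i\in\ell^\infty(X),\ V_i\text{ partial translations}\}$. A representation of $\mathbb C_u[X]$ on a Banach space $B$ is a unital algebra homomorphism $\pi:\mathbb C_u[X]\to\mathcal L(B)$ with $\|\pi(T)\|\le\|T\|_{\ell^1}$. $B^\pi=\{\xi:\pi(V)\xi=\pi(\chi_{R_V})\xi\ \forall\text{ partial translations }V\}$. The dual representation on $B^*$ is $(\pi^*(T)f)(\xi)=f(\pi(T^* )\xi)$, its invariant space $(B^* )^{\pi^*}$ is defined in the same way, and $B_\pi=\{\xi\in B: f(\xi)=0\ \forall f\in(B^* )^{\pi^*}\}$. When $B$ is uniformly convex, $B=B^\pi\oplus B_\pi$. $\pi$ has a spectral gap greater than $c$ if, for some $c'>c$, for every $\xi$ with $\|[\xi]\|_{B/B^\pi}=1$ there is a partial translation $V$ with $\mathrm{supp}(V)\subseteq E_0$ and $\|[\pi(V)\xi-\pi(\chi_{R_V})\xi]\|_{B/B^\pi}\ge c'$. $X$ has uniform geometric property $(T_{\mathscr B})$ if there is $c>0$ such that all representations of $\mathbb C_u[X]$ on all $B\in\mathscr B$ have a spectral gap greater than $c$. $C_{\mathscr B,\max}(X)$ is the completion of $\mathbb C_u[X]$ in the norm $\|a\|_{\mathscr B,\max}=\sup\{\|\pi(a)\|:\pi\text{ a representation on some }B\in\mathscr B\}$; every such $\pi$ extends to $C_{\mathscr B,\max}(X)$, still denoted $\pi$.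 With $\delta_B(t)=\inf\{1-\|\xi+\eta\|/2:\|\xi\|=\|\eta\|=1,\|\xi-\eta\|\ge t\}$, the family $\mathscr B$ is uniformly convex if $\inf_{B\in\mathscr B}\delta_B(t)>0$ for all $t\in(0,2]$. $\mathscr B$ is closed under ultraproducts if for every sequence $(B_n)$ in $\mathscr B$ and non-principal ultrafilter $\omega$ on $\mathbb N$, the space of bounded sequences $(\xi_n)\in\prod B_n$ modulo those with $\lim_{\omega}\|\xi_n\|=0$, with norm $\lim_\omega\|\xi_n\|$, belongs to $\mathscr B$. *)

(* Defs.v *)
From HB Require Import structures.
From mathcomp Require Import all_boot all_order all_algebra.
From mathcomp Require Import finmap complex.
From mathcomp Require Import all_classical all_reals all_analysis.

Set Implicit Arguments.
Unset Strict Implicit.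
Unset Printing Implicit Defensive.

Import Order.TTheory GRing.Theory Num.Theory.
Import numFieldNormedType.Exports.

Local Open Scope classical_set_scope.
Local Open Scope ring_scope.

(* MathComp-Analysis norms on complex spaces take values in R[i]; [nrm] is the
   same norm with values in R. *)
Definition nrm (R : realType) (V : normedZmodType R[i]) (v : V) : R :=
  complex.Re `|v|.

Section Nrm.
Context {R : realType} {V : normedZmodType R[i]}.
Implicit Types v w : V.

Lemma nrmE v : `|v| = (nrm v)%:C%C.
Proof. by rewrite /nrm (RRe_real (normr_real v)). Qed.

Lemma nrm_ge0 v : 0 <= nrm v.
Proof. by have := normr_ge0 v; rewrite nrmE lecR. Qed.

Lemma nrm0 : nrm (0 : V) = 0.
Proof. by rewrite /nrm normr0. Qed.

Lemma nrmN v : nrm (- v) = nrm v.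
Proof. by rewrite /nrm normrN. Qed.

Lemma nrm_eq0 v : nrm v = 0 -> v = 0.
Proof. by move=> h; apply/eqP; rewrite -normr_eq0 nrmE h. Qed.

Lemma nrmD v w : nrm (v + w) <= nrm v + nrm w.
Proof. by rewrite -lecR rmorphD/= -!nrmE ler_normD. Qed.

Lemma nrm_sum I (s : seq I) (F : I -> V) :
  nrm (\sum_(i <- s) F i) <= \sum_(i <- s) nrm (F i).
Proof.
elim/big_ind2: _ => [|x y z t hx hz|//]; first by rewrite nrm0.
by rewrite (le_trans (nrmD _ _))// lerD.
Qed.

End Nrm.

Lemma nrmM (R : realType) (a b : R[i]) : nrm (a * b) = nrm a * nrm b.
Proof. by apply: complexI; rewrite rmorphM/= -!nrmE normrM. Qed.

Lemma nrmZ (R : realType) (V : normedModType R[i]) (a : R[i]) (v : V) :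
  nrm (a *: v) = nrm a * nrm v.
Proof. by apply: complexI; rewrite rmorphM/= -!nrmE normrZ. Qed.

Record extMetric (R : realType) := ExtMetric {
  em_carrier :> choiceType;
  edist : em_carrier -> em_carrier -> \bar R;
  edist_ge0 : forall x y, (0 <= edist x y)%E;
  edist_eq0 : forall x y, edist x y = 0%E <-> x = y;
  edist_sym : forall x y, edist x y = edist y x;
  edist_triangle : forall x y z, (edist x z <= edist x y + edist y z)%E
}.

Section Coarse.
Context {R : realType}.
Implicit Types X : extMetric R.

Definition eball X (x : X) (r : R) : set X := [set y | (edist x y <= r%:E)%E].

Definition bounded_geometry X : Prop :=
  forall r : R, 0 < r -> exists N : nat, forall x : X, (eball x r #<= `I_N)%card.

Definition Delta X (r : R) : set (X * X) := [set u | (edist u.1 u.2 <= r%:E)%E].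

Definition is_entourage X (E : set (X * X)) : Prop :=
  exists r : R, E `<=` Delta r.

Definition rel_comp X (E F : set (X * X)) : set (X * X) :=
  [set u | exists z, E (u.1, z) /\ F (z, u.2)].

Definition rel_diag X : set (X * X) := [set u | u.1 = u.2].

Definition rel_iter X (E : set (X * X)) (n : nat) : set (X * X) :=
  iter n (rel_comp E) (@rel_diag X).

Definition generating X (E : set (X * X)) : Prop :=
  is_entourage E /\
  forall F : set (X * X), is_entourage F ->
    exists n, (0 < n)%N /\ F `<=` rel_iter E n.

Definition monogenic X : Prop := exists E : set (X * X), generating E.

Definition rel_symmetric X (E : set (X * X)) : Prop :=
  forall x y : X, E (x, y) -> E (y, x).

End Coarse.

(* The separated disjoint union; some Y n may be empty, so finite families of
   pieces are covered. *)
Section DisjUnion.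
Context {R : realType}.
Variable Y : nat -> extMetric R.

Definition du_carrier : choiceType := {n : nat & Y n}.

Definition du_dist (u v : du_carrier) : \bar R :=
  if tag u == tag v then edist (tagged u) (tagged_as u v) else +oo%E.

Lemma du_dist_same n (x y : Y n) :
  du_dist (Tagged Y x) (Tagged Y y) = edist x y.
Proof. by rewrite /du_dist eqxx tagged_asE. Qed.

Lemma du_dist_diff (u v : du_carrier) : tag u != tag v -> du_dist u v = +oo%E.
Proof. by rewrite /du_dist => /negbTE ->. Qed.

Lemma du_dist_ge0 u v : (0 <= du_dist u v)%E.
Proof. by rewrite /du_dist; case: ifP => // _; exact: edist_ge0. Qed.

Lemma du_dist_eq0 u v : du_dist u v = 0%E <-> u = v.
Proof.
case: u v => [n x] [m y]; have [e|ne] := eqVneq n m.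
  subst m; rewrite du_dist_same edist_eq0; split=> [->//|e].
  by apply/eqP; rewrite -(@eq_Tagged _ _ (Tagged Y x) y)/=; apply/eqP.
rewrite du_dist_diff//; split=> [//|e].
by case/eqP: ne; exact: (congr1 tag e).
Qed.

Lemma du_dist_sym u v : du_dist u v = du_dist v u.
Proof.
case: u v => [n x] [m y]; have [e|ne] := eqVneq n m.
  by subst m; rewrite !du_dist_same edist_sym.
by rewrite !du_dist_diff// eq_sym.
Qed.

Lemma du_dist_triangle u v w : (du_dist u w <= du_dist u v + du_dist v w)%E.
Proof.
case: u v w => [n x] [m y] [k z]; have [e|ne] := eqVneq n m; last first.
  by rewrite (@du_dist_diff (existT _ n x) (existT _ m y))// addye ?leey// gt_eqF//
     (lt_le_trans _ (du_dist_ge0 _ _)).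
subst m; have [e|ne] := eqVneq n k; last first.
  rewrite (@du_dist_diff (existT _ n y) (existT _ k z))// addey ?leey// gt_eqF//.
  by rewrite (lt_le_trans _ (du_dist_ge0 _ _)).
by subst k; rewrite !du_dist_same edist_triangle.
Qed.

Definition disjUnion : extMetric R :=
  ExtMetric du_dist_ge0 du_dist_eq0 du_dist_sym du_dist_triangle.

End DisjUnion.

Record bgSpace (R : realType) := BGSpace {
  bg_space :> extMetric R;
  bg_bounded : bounded_geometry bg_space
}.

Section BallSums.
Context {R : realType} {X : bgSpace R}.

Lemma eball_finite (x : X) (r : R) : finite_set (eball x r).
Proof.
have [|N h] := @bg_bounded _ X (Order.max r 1).
  by rewrite lt_max ltr01 orbT.
apply: (@sub_finite_set _ _ (eball x (Order.max r 1))).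
  by move=> y /= /le_trans; apply; rewrite lee_fin le_max lexx.
by apply/finite_set_leP; exists N; exact: h.
Qed.

Definition eballs (x : X) (r : R) : seq X := fset_set (eball x r).

Lemma mem_eballs x r z : (z \in eballs x r) <-> eball x r z.
Proof. by rewrite /eballs in_fset_set ?inE//; exact: eball_finite. Qed.

Lemma size_eballs r : exists N, forall x, (size (eballs x r) <= N)%N.
Proof.
have [|N h] := @bg_bounded _ X (Order.max r 1).
  by rewrite lt_max ltr01 orbT.
exists N => x; apply: geq_card_fset_set; apply: card_le_trans (h x).
apply: subset_card_le => y /= /le_trans; apply.
by rewrite lee_fin le_max lexx.
Qed.

Lemma ball_sum (x : X) (r : R) (F : X -> R[i]) :
  (forall z, F z != 0 -> eball x r z) ->
  \sum_(z \in [set: X]) F z = \sum_(z <- eballs x r) F z.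
Proof.
move=> h; rewrite -(@fsbig_widen _ _ _ _ (eball x r) [set: X])//.
  by rewrite fsbig_finite//; exact: eball_finite.
by move=> z [_ hz] /=; apply/eqP/negPn/negP => /h.
Qed.

End BallSums.

Section Roe.
Context {R : realType} {X : bgSpace R}.
Implicit Types S T U : X -> X -> R[i].

Definition supp T : set (X * X) := [set u | T u.1 u.2 != 0].

Definition in_Cu T : Prop :=
  (exists M : R, forall x y, nrm (T x y) <= M) /\ is_entourage (supp T).

Definition Cu_pred : {pred X -> X -> R[i]} := fun T => `[< in_Cu T >].

Lemma Cu_predP T : reflect (in_Cu T) (T \in Cu_pred).
Proof. exact: asboolP. Qed.

Lemma in_Cu_data T : in_Cu T ->
  exists M r : R, [/\ 0 <= M, forall x y, nrm (T x y) <= M &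
    forall x y, T x y != 0 -> eball x r y].
Proof.
move=> [[M hM] [r hr]]; exists (Order.max 0 M), r; split.
- by rewrite le_max lexx.
- by move=> x y; rewrite le_max hM orbT.
- by move=> x y; exact: (hr (x, y)).
Qed.

Lemma Cu_submod_closed : submod_closed Cu_pred.
Proof.
split=> [|a S T /Cu_predP/in_Cu_data[M [r [M0 hM hr]]]
          /Cu_predP/in_Cu_data[N [s [N0 hN hs]]]].
  apply/Cu_predP; split; first by exists 0 => x y; rewrite nrm0.
  by exists 0 => -[x y]; rewrite /supp/= eqxx.
apply/Cu_predP; split.
  exists (nrm a * M + N) => x y.
  rewrite (le_trans (nrmD _ _))// lerD// nrmM ler_wpM2l// ?nrm_ge0//.
exists (Order.max r s) => -[x y] h.
have {}h : a * S x y + T x y != 0 := h.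
have [e|ne] := eqVneq (S x y) 0.
  have : T x y != 0.
    by apply: contra_neq h => e'; rewrite e e' mulr0 addr0.
  by move=> /hs /le_trans; apply; rewrite lee_fin le_max lexx orbT.
by have /le_trans := hr _ _ ne; apply; rewrite lee_fin le_max lexx.
Qed.

HB.instance Definition _ :=
  GRing.isSubmodClosed.Build R[i] (X -> X -> R[i]) Cu_pred Cu_submod_closed.

(* \sum_(z \in A) is the finitely supported sum; for S in C_u[X] and X of bounded
   geometry the support is finite, see mat_mulE. *)
Definition mat_mul S T : X -> X -> R[i] :=
  fun x y => \sum_(z \in [set: X]) S x z * T z y.

Definition mat_diag (f : X -> R[i]) : X -> X -> R[i] :=
  fun x y => if x == y then f x else 0.

Definition mat_adj T : X -> X -> R[i] := fun x y => conjc (T y x).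

Lemma mat_mulE S T (r : R) x y :
  (forall x z, S x z != 0 -> eball x r z) ->
  mat_mul S T x y = \sum_(z <- eballs x r) S x z * T z y.
Proof.
move=> h; apply: ball_sum => z; rewrite mulf_eq0 negb_or => /andP[+ _].
exact: h.
Qed.

Lemma mat_mul_supp S T (r s : R) x y :
  (forall x z, S x z != 0 -> eball x r z) ->
  (forall x z, T x z != 0 -> eball x s z) ->
  mat_mul S T x y != 0 -> eball x (r + s) y.
Proof.
move=> hS hT h.
have [z hz] : exists z, S x z * T z y != 0.
  apply: contra_neqP h => /forallNP h.
  by apply: fsbig1 => z _; apply/eqP/negPn/negP/h.
move: hz; rewrite mulf_eq0 negb_or => /andP[/hS h1 /hT h2].
rewrite /eball/= (le_trans (edist_triangle _ z _))// EFinD.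
exact: leeD.
Qed.

Lemma mat_mul_in S T : in_Cu S -> in_Cu T -> in_Cu (mat_mul S T).
Proof.
move=> /in_Cu_data[M [r [M0 hM hr]]] /in_Cu_data[N [s [N0 hN hs]]]; split.
  have [K hK] := size_eballs (X := X) r.
  exists (K%:R * (M * N)) => x y.
  rewrite (mat_mulE _ _ _ hr) (le_trans (nrm_sum _ _))//.
  apply: (@le_trans _ _ (\sum_(z <- eballs x r) M * N)).
    by apply: ler_sum => z _; rewrite nrmM ler_pM// nrm_ge0.
  rewrite big_const_seq count_predT iter_addr_0 -[X in X <= _]mulr_natl.
  by rewrite ler_wpM2r ?mulr_ge0 ?ler_nat.
by exists (r + s) => -[x y] /=; exact: mat_mul_supp.
Qed.

Lemma mat_diag_in f : (exists M : R, forall x, nrm (f x) <= M) ->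
  in_Cu (mat_diag f).
Proof.
move=> [M hM]; split.
  exists (Order.max M 0) => x y; rewrite /mat_diag; case: eqP => _.
    by rewrite le_max hM.
  by rewrite nrm0 le_max lexx orbT.
exists 0 => -[x y] /=; rewrite /supp /mat_diag/=; case: (x =P y) => [<- _|_].
  by rewrite /Delta/= ((edist_eq0 x x).2 erefl).
by rewrite eqxx.
Qed.

Lemma mat_diag_mull f T x y : mat_mul (mat_diag f) T x y = f x * T x y.
Proof.
rewrite /mat_mul -(@fsbig_widen _ _ _ _ [set x] [set: X])//.
  by rewrite fsbig_set1 /mat_diag eqxx.
move=> z [_ /= hz]; rewrite /mat_diag ifN ?mul0r//.
by apply/eqP => e; apply: hz.
Qed.

Lemma mat_diag_mulr f T x y : mat_mul T (mat_diag f) x y = T x y * f y.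
Proof.
rewrite /mat_mul -(@fsbig_widen _ _ _ _ [set y] [set: X])//.
  by rewrite fsbig_set1 /mat_diag eqxx.
by move=> z [_ /= /eqP/negbTE hz]; rewrite /mat_diag hz mulr0.
Qed.

Lemma nrm_conjc (a : R[i]) : nrm (conjc a) = nrm a.
Proof. by rewrite /nrm normcJ. Qed.

Lemma mat_adj_in T : in_Cu T -> in_Cu (mat_adj T).
Proof.
move=> [[M hM] [r hr]]; split.
  by exists M => x y; rewrite nrm_conjc.
exists r => -[x y] /=; rewrite /supp /mat_adj/= conjc_eq0 => h.
by rewrite /Delta/= edist_sym; exact: (hr (y, x)).
Qed.

End Roe.

(* Elements of C_u[X]; the ring structure below is matrix multiplication, not
   the pointwise product. *)
Record Cu (R : realType) (X : bgSpace R) := MkCu {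
  Cu_mx :> X -> X -> R[i];
  Cu_mxP : Cu_mx \in Cu_pred
}.

Section CuAlgebra.
Context {R : realType} {X : bgSpace R}.

HB.instance Definition _ := [isSub for @Cu_mx R X].
HB.instance Definition _ := [Choice of Cu X by <:].
HB.instance Definition _ := [SubChoice_isSubLmodule of Cu X by <:].

Lemma CuP (T : Cu X) : in_Cu T.
Proof. exact/Cu_predP/Cu_mxP. Qed.

Lemma Cu_ext (S T : Cu X) : (forall x y, S x y = T x y) -> S = T.
Proof. by move=> h; apply: val_inj; apply/funext => x; apply/funext => y; exact: h. Qed.

Definition Cu_of (T : X -> X -> R[i]) (hT : in_Cu T) : Cu X :=
  MkCu (introT (Cu_predP T) hT).

Lemma bounded_one : exists M : R, forall x : X, nrm (1 : R[i]) <= M.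
Proof. by exists (nrm (1 : R[i])). Qed.

Definition Cu_one : Cu X := Cu_of (mat_diag_in bounded_one).
Definition Cu_mul (S T : Cu X) : Cu X := Cu_of (mat_mul_in (CuP S) (CuP T)).
Definition Cu_adj (T : Cu X) : Cu X := Cu_of (mat_adj_in (CuP T)).

Lemma Cu_mulA : associative Cu_mul.
Proof.
move=> S T U; apply: Cu_ext => x y /=.
have [M [r [M0 hM hr]]] := in_Cu_data (CuP S).
have [N [s [N0 hN hs]]] := in_Cu_data (CuP T).
rewrite (mat_mulE _ _ _ hr) (mat_mulE _ _ _ (fun x z => mat_mul_supp hr hs)).
transitivity (\sum_(z <- eballs x r) \sum_(w <- eballs x (r + s))
    S x z * (T z w * U w y)).
  apply: eq_big_seq => z /mem_eballs hz; rewrite -big_distrr/=; congr (_ * _).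
  apply: ball_sum => w; rewrite mulf_eq0 negb_or => /andP[/hs h2 _].
  rewrite /eball/= (le_trans (edist_triangle _ z _))// EFinD.
  exact: leeD.
rewrite exchange_big/=; apply: eq_bigr => w _.
rewrite (mat_mulE _ _ _ hr) big_distrl/=.
by apply: eq_bigr => z _; rewrite mulrA.
Qed.

Lemma Cu_mul1l : left_id Cu_one Cu_mul.
Proof. by move=> T; apply: Cu_ext => x y /=; rewrite mat_diag_mull mul1r. Qed.

Lemma Cu_mul1r : right_id Cu_one Cu_mul.
Proof. by move=> T; apply: Cu_ext => x y /=; rewrite mat_diag_mulr mulr1. Qed.

Lemma Cu_mulDl : left_distributive Cu_mul +%R.
Proof.
move=> S T U; apply: Cu_ext => x y.
have [_ [r [_ _ hr]]] := in_Cu_data (CuP S).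
have [_ [s [_ _ hs]]] := in_Cu_data (CuP T).
have [_ [t [_ _ ht]]] := in_Cu_data (CuP (S + T)).
pose m := Order.max r (Order.max s t).
have ballW (a : R) u v : a <= m -> eball (X := X) u a v -> eball u m v.
  by move=> am /le_trans; apply; rewrite lee_fin.
have hrm u v : S u v != 0 -> eball u m v.
  by move=> /hr; apply: ballW; rewrite le_max lexx.
have hsm u v : T u v != 0 -> eball u m v.
  by move=> /hs; apply: ballW; rewrite !le_max lexx orbT.
have htm u v : (S + T : Cu X) u v != 0 -> eball u m v.
  by move=> /ht; apply: ballW; rewrite !le_max lexx !orbT.
rewrite [LHS](mat_mulE _ _ _ htm).
rewrite -[RHS]/(mat_mul S U x y + mat_mul T U x y).
rewrite (mat_mulE _ _ _ hrm) (mat_mulE _ _ _ hsm) -big_split/=.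
by apply: eq_bigr => z _; rewrite -mulrDl.
Qed.

Lemma Cu_mulDr : right_distributive Cu_mul +%R.
Proof.
move=> S T U; apply: Cu_ext => x y.
have [_ [r [_ _ hr]]] := in_Cu_data (CuP S).
rewrite [LHS](mat_mulE _ _ _ hr).
rewrite -[RHS]/(mat_mul S T x y + mat_mul S U x y).
rewrite !(mat_mulE _ _ _ hr) -big_split/=.
by apply: eq_bigr => z _; rewrite -mulrDr.
Qed.

HB.instance Definition _ := GRing.Zmodule_isPzRing.Build (Cu X)
  Cu_mulA Cu_mul1l Cu_mul1r Cu_mulDl Cu_mulDr.

End CuAlgebra.

(* The Hausdorff completion of a ring for a submultiplicative seminorm: Cauchy
   sequences modulo null sequences. *)

Record ringSeminorm (R : realType) (A : pzRingType) := RingSeminorm {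
  rsn :> A -> R;
  rsn0 : rsn 0 = 0;
  rsnN : forall a, rsn (- a) = rsn a;
  rsnD : forall a b, rsn (a + b) <= rsn a + rsn b;
  rsnM : forall a b, rsn (a * b) <= rsn a * rsn b
}.

Section Completion.
Context {R : realType} {A : pzRingType}.
Variable N : ringSeminorm R A.

Lemma rsn_ge0 a : 0 <= N a.
Proof.
by have := rsnD N a (- a); rewrite rsnN subrr rsn0 -mulr2n pmulrn_lge0.
Qed.

Definition is_cauchy (u : nat -> A) : Prop := forall e : R, 0 < e ->
  exists n0, forall m n, (n0 <= m)%N -> (n0 <= n)%N -> N (u m - u n) < e.

Definition is_null (u : nat -> A) : Prop := forall e : R, 0 < e ->
  exists n0, forall n, (n0 <= n)%N -> N (u n) < e.

Definition cauchy_pred : {pred nat -> A} := fun u => `[< is_cauchy u >].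

Lemma cauchy_predP (u : nat -> A) : reflect (is_cauchy u) (u \in cauchy_pred).
Proof. exact: asboolP. Qed.

Lemma is_cauchy_bounded (u : nat -> A) : is_cauchy u ->
  exists2 M, 0 < M & forall n, N (u n) <= M.
Proof.
move=> /(_ 1 ltr01)[n0 h]; exists (\sum_(i < n0.+1) N (u i) + 1).
  by rewrite ltr_wpDl// sumr_ge0// => i _; exact: rsn_ge0.
have hs k : (k <= n0)%N -> N (u k) <= \sum_(i < n0.+1) N (u i).
  move=> hk; rewrite (bigD1 (inord k))//= inordK// lerDl sumr_ge0// => i _.
  exact: rsn_ge0.
move=> n; have [ln|/ltnW ln] := leqP n n0.
  by rewrite (le_trans (hs _ ln))// lerDl.
rewrite -[u n](subrK (u n0)) (le_trans (rsnD _ _ _))// addrC lerD//.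
  exact: hs.
by rewrite ltW// h.
Qed.

Lemma cauchy_subring_closed : subring_closed cauchy_pred.
Proof.
split=> [|u v /cauchy_predP hu /cauchy_predP hv|
          u v /cauchy_predP hu /cauchy_predP hv]; apply/cauchy_predP => e e0.
- by exists 0%N => m n _ _; rewrite subrr rsn0.
- have e2 : 0 < e / 2 by rewrite divr_gt0.
  have [n1 h1] := hu _ e2; have [n2 h2] := hv _ e2.
  exists (maxn n1 n2) => m n; rewrite !geq_max => /andP[m1 m2] /andP[k1 k2].
  rewrite [X in N X](_ : _ = (u m - u n) + - (v m - v n)); last first.
    by rewrite -[LHS]/(u m - v m - (u n - v n)) !opprD !opprK addrACA.
  by rewrite (le_lt_trans (rsnD _ _ _))// rsnN [ltRHS]splitr ltrD// ?h1// h2.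
have [K K0 hK] := is_cauchy_bounded hu; have [L L0 hL] := is_cauchy_bounded hv.
have eK : 0 < e / 2 / K by rewrite !divr_gt0.
have eL : 0 < e / 2 / L by rewrite !divr_gt0.
have [n1 h1] := hu _ eL; have [n2 h2] := hv _ eK.
exists (maxn n1 n2) => m n; rewrite !geq_max => /andP[m1 m2] /andP[k1 k2].
rewrite [X in N X](_ : _ = (u m - u n) * v m + u n * (v m - v n)); last first.
  by rewrite mulrBl mulrBr addrA subrK.
rewrite (le_lt_trans (rsnD _ _ _))// [ltRHS]splitr ltrD//.
  rewrite (le_lt_trans (rsnM _ _ _))// (@le_lt_trans _ _ (N (u m - u n) * L))//.
    by rewrite ler_wpM2l// rsn_ge0.
  by rewrite -ltr_pdivlMr// h1.
rewrite (le_lt_trans (rsnM _ _ _))// (@le_lt_trans _ _ (K * N (v m - v n)))//.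
  by rewrite ler_wpM2r// rsn_ge0.
by rewrite mulrC -ltr_pdivlMr// h2.
Qed.

HB.instance Definition _ :=
  GRing.isSubringClosed.Build (nat -> A) cauchy_pred cauchy_subring_closed.

Record cauchySeq := CauchySeq {
  cs_seq :> nat -> A;
  cs_seqP : cs_seq \in cauchy_pred
}.

HB.instance Definition _ := [isSub for cs_seq].
HB.instance Definition _ := [Choice of cauchySeq by <:].
HB.instance Definition _ := GRing.SubChoice_isSubPzRing.Build
  (nat -> A) cauchy_pred cauchySeq cauchy_subring_closed.

Lemma csP (u : cauchySeq) : is_cauchy u.
Proof. exact/cauchy_predP/cs_seqP. Qed.

Definition null_pred : {pred cauchySeq} :=
  fun u : cauchySeq => `[< is_null u >].

Lemma null_predP (u : cauchySeq) : reflect (is_null u) (u \in null_pred).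
Proof. exact: asboolP. Qed.

Lemma null_zmod_closed : zmod_closed null_pred.
Proof.
split=> [|u v /null_predP hu /null_predP hv]; apply/null_predP => e e0.
  by exists 0%N => n _; rewrite rsn0.
have e2 : 0 < e / 2 by rewrite divr_gt0.
have [n1 h1] := hu _ e2; have [n2 h2] := hv _ e2.
exists (maxn n1 n2) => n; rewrite !geq_max => /andP[m1 m2].
by rewrite (le_lt_trans (rsnD _ _ _))// rsnN [ltRHS]splitr ltrD// ?h1// h2.
Qed.

HB.instance Definition _ :=
  GRing.isZmodClosed.Build cauchySeq null_pred null_zmod_closed.

Lemma null_mull (u v : cauchySeq) : v \in null_pred -> u * v \in null_pred.
Proof.
move=> /null_predP hv; apply/null_predP => e e0.
have [K K0 hK] := is_cauchy_bounded (csP u).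
have [n0 h] := hv (e / K) (divr_gt0 e0 K0).
exists n0 => n /h hn; rewrite (le_lt_trans (rsnM _ _ _))//.
rewrite (@le_lt_trans _ _ (K * N (v n)))//; first by rewrite ler_wpM2r// rsn_ge0.
by rewrite mulrC -ltr_pdivlMr.
Qed.

Lemma null_mulr (u v : cauchySeq) : u \in null_pred -> u * v \in null_pred.
Proof.
move=> /null_predP hu; apply/null_predP => e e0.
have [K K0 hK] := is_cauchy_bounded (csP v).
have [n0 h] := hu (e / K) (divr_gt0 e0 K0).
exists n0 => n /h hn; rewrite (le_lt_trans (rsnM _ _ _))//.
rewrite (@le_lt_trans _ _ (N (u n) * K))//; first by rewrite ler_wpM2l// rsn_ge0.
by rewrite -ltr_pdivlMr.
Qed.

Local Open Scope quotient_scope.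

Definition completion : Type := Quotient.quot null_pred.
HB.instance Definition _ := GRing.Zmodule.on completion.
HB.instance Definition _ := EqQuotient.on completion.

Definition cpl_class (u : cauchySeq) : completion := \pi_completion u.

Lemma cpl_classE (u v : cauchySeq) :
  cpl_class u = cpl_class v <-> is_null (cs_seq u - cs_seq v).
Proof.
split=> [/eqP|h].
  by rewrite -Quotient.idealrBE => /null_predP.
by apply/eqP; rewrite -Quotient.idealrBE; apply/null_predP.
Qed.

Definition cpl_one : completion := cpl_class 1.
Definition cpl_mul (p q : completion) : completion :=
  cpl_class (repr p * repr q).

Lemma cpl_mulE (u v : cauchySeq) :
  cpl_mul (cpl_class u) (cpl_class v) = cpl_class (u * v).
Proof.
apply/eqP; rewrite -Quotient.idealrBE.
set u' := repr _; set v' := repr _.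
have hu : u' - u \in null_pred by rewrite Quotient.idealrBE reprK.
have hv : v' - v \in null_pred by rewrite Quotient.idealrBE reprK.
rewrite (_ : _ - _ = (u' - u) * v' + u * (v' - v)); last first.
  by rewrite mulrBl mulrBr addrA subrK.
by apply: rpredD; [exact: null_mulr|exact: null_mull].
Qed.

Lemma cpl_ind (P : completion -> Prop) :
  (forall u, P (cpl_class u)) -> forall p, P p.
Proof. by move=> h p; rewrite -[p]reprK; exact: h. Qed.

Lemma cpl_addE (u v : cauchySeq) : cpl_class u + cpl_class v = cpl_class (u + v).
Proof. by rewrite /cpl_class !piE. Qed.

Lemma cpl_mulA : associative cpl_mul.
Proof.
elim/cpl_ind => u; elim/cpl_ind => v; elim/cpl_ind => w.
by rewrite !cpl_mulE mulrA.
Qed.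

Lemma cpl_mul1l : left_id cpl_one cpl_mul.
Proof. by elim/cpl_ind => u; rewrite cpl_mulE mul1r. Qed.

Lemma cpl_mul1r : right_id cpl_one cpl_mul.
Proof. by elim/cpl_ind => u; rewrite cpl_mulE mulr1. Qed.

Lemma cpl_mulDl : left_distributive cpl_mul +%R.
Proof.
elim/cpl_ind => u; elim/cpl_ind => v; elim/cpl_ind => w.
by rewrite cpl_addE !cpl_mulE cpl_addE mulrDl.
Qed.

Lemma cpl_mulDr : right_distributive cpl_mul +%R.
Proof.
elim/cpl_ind => u; elim/cpl_ind => v; elim/cpl_ind => w.
by rewrite cpl_addE !cpl_mulE cpl_addE mulrDr.
Qed.

HB.instance Definition _ := GRing.Zmodule_isPzRing.Build completion
  cpl_mulA cpl_mul1l cpl_mul1r cpl_mulDl cpl_mulDr.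

Lemma cst_cauchy (a : A) : (fun=> a) \in cauchy_pred.
Proof.
by apply/cauchy_predP => e e0; exists 0%N => m n _ _; rewrite subrr rsn0.
Qed.

Definition to_completion (a : A) : completion := cpl_class (CauchySeq (cst_cauchy a)).

End Completion.

Section PartialTranslations.
Context {R : realType} {X : bgSpace R}.
Implicit Types (f T V : Cu X).

Definition is_diagonal f : Prop := forall x y, x != y -> f x y = 0.

Definition supnorm f : R := sup [set nrm (f x x) | x in [set: X]].

Definition partial_translation V : Prop :=
  [/\ forall x y, V x y = 0 \/ V x y = 1,
      forall x y y', V x y != 0 -> V x y' != 0 -> y = y' &
      forall x x' y, V x y != 0 -> V x' y != 0 -> x = x'].

Definition pt_range V : set X := [set x | exists y, V x y = 1].

Definition indicator (A : set X) (x : X) : R[i] := if x \in A then 1 else 0.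

Lemma indicator_bounded (A : set X) :
  exists M : R, forall x, nrm (indicator A x) <= M.
Proof.
exists (nrm (1 : R[i])) => x; rewrite /indicator; case: ifP => // _.
by rewrite nrm0 nrm_ge0.
Qed.

Definition chi (A : set X) : Cu X := Cu_of (mat_diag_in (indicator_bounded A)).

Definition l1norm T : R :=
  inf [set s | exists (n : nat) (f V : 'I_n -> Cu X),
    [/\ forall i, is_diagonal (f i),
        forall i, partial_translation (V i),
        T = \sum_(i < n) f i * V i &
        s = \sum_(i < n) supnorm (f i)]].

End PartialTranslations.

Definition opnorm (R : realType) (B : normedModType R[i]) (f : B -> B) : R :=
  sup [set nrm (f v) | v in [set v | nrm v <= 1]].

Record representation (R : realType) (X : bgSpace R)
    (B : completeNormedModType R[i]) := Representation {
  rep_op :> Cu X -> {linear B -> B};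
  rep_continuous : forall T, continuous (rep_op T);
  repD : forall S T v, rep_op (S + T) v = rep_op S v + rep_op T v;
  repZ : forall (a : R[i]) T v, rep_op (a *: T) v = a *: rep_op T v;
  repM : forall S T v, rep_op (S * T) v = rep_op S (rep_op T v);
  rep1 : forall v, rep_op 1 v = v;
  rep_l1norm : forall T, opnorm (rep_op T) <= l1norm T
}.

Section Invariants.
Context {R : realType} {X : bgSpace R}.

(* E is an arbitrary carrier so that the same definition applies to the dual
   representation, which acts on functionals. *)
Definition invariants (E : Type) (rho : Cu X -> E -> E) : set E :=
  [set v | forall V, partial_translation V -> rho V v = rho (chi (pt_range V)) v].

Context {B : completeNormedModType R[i]}.
Variable pi : representation X B.

Definition rep_inv : set B := invariants (fun T v => pi T v).

Definition dual_space : set (B -> R[i]) :=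
  [set f | linear (f : B -> R[i]^o) /\ continuous (f : B -> R[i]^o)].

Definition dual_rep (T : Cu X) (f : B -> R[i]) : B -> R[i] :=
  fun v => f (pi (Cu_adj T) v).

Definition dual_inv : set (B -> R[i]) := dual_space `&` invariants dual_rep.

Definition rep_ann : set B := [set v | forall f, dual_inv f -> f v = 0].

(* The norm of the class of v in the quotient by S. *)
Definition quot_nrm (S : set B) (v : B) : R := inf [set nrm (v - w) | w in S].

Definition has_spectral_gap (E0 : set (X * X)) (c : R) : Prop :=
  exists2 c', c < c' & forall v, quot_nrm rep_inv v = 1 ->
    exists V, [/\ partial_translation V, supp V `<=` E0 &
      c' <= quot_nrm rep_inv (pi V v - pi (chi (pt_range V)) v)].

End Invariants.

Definition idempotent_onto_along (V : zmodType) (P : V -> V) (U W : set V) : Prop :=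
  [/\ P \o P = P, range P = U & P @^-1` [set 0] = W].

Section Families.
Context {R : realType}.
Variable BB : completeNormedModType R[i] -> Prop.

Definition uniform_geometric_property_T (X : bgSpace R) (E0 : set (X * X)) : Prop :=
  exists2 c : R, 0 < c &
    forall B, BB B -> forall pi : representation X B, has_spectral_gap pi E0 c.

(* The infima below are taken in \bar R, so that the infimum of the empty set is +oo. *)
Definition convexity_modulus (B : normedModType R[i]) (t : R) : \bar R :=
  ereal_inf [set (1 - nrm (v.1 + v.2) / 2)%:E | v in
    [set v : B * B | [/\ nrm v.1 = 1, nrm v.2 = 1 & t <= nrm (v.1 - v.2)]]].

Definition uniformly_convex_family : Prop := forall t : R, 0 < t <= 2 ->
  (0 < ereal_inf [set d | exists B, BB B /\ d = convexity_modulus B t])%E.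

Definition nonprincipal (omega : set_system nat) : Prop :=
  forall n, ~ omega [set n].

Definition bounded_sequence (Bs : nat -> completeNormedModType R[i])
    (v : forall n, Bs n) : Prop := exists M : R, forall n, nrm (v n) <= M.

(* U is, up to isometric isomorphism, the space of bounded sequences modulo those
   whose norm tends to 0 along omega; q is the quotient map, and only its values
   on bounded sequences are relevant. *)
Definition is_ultraproduct (omega : set_system nat)
    (Bs : nat -> completeNormedModType R[i]) (U : completeNormedModType R[i])
    (q : (forall n, Bs n) -> U) : Prop :=
  [/\ forall (a : R[i]) v w, bounded_sequence v -> bounded_sequence w ->
        q (fun n => a *: v n + w n) = a *: q v + q w,
      forall u : U, exists2 v, bounded_sequence v & q v = u &
      forall v, bounded_sequence v -> nrm (v n) @[n --> omega] --> nrm (q v)].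

Definition closed_under_ultraproducts : Prop :=
  forall (Bs : nat -> completeNormedModType R[i]) (omega : set_system nat),
    (forall n, BB (Bs n)) -> UltraFilter omega -> nonprincipal omega ->
    exists U q, @is_ultraproduct omega Bs U q /\ BB U.

End Families.

Section OperatorNorm.
Context {R : realType} {B : completeNormedModType R[i]}.
Implicit Types f g : {linear B -> B}.

Lemma opnorm_has_sup f : continuous f ->
  has_sup [set nrm (f v) | v in [set v | nrm v <= 1]].
Proof.
move=> cf; split; first by exists (nrm (f 0)), 0 => //=; rewrite nrm0.
have /linear_bounded_continuous/linear_boundedP/pinfty_ex_gt0[r r0 hr] := cf.
have rE : r = (complex.Re r)%:C%C by rewrite RRe_real// gtr0_real.
exists (complex.Re r) => _ [v /= v1 <-].
rewrite -lecR -nrmE -rE (le_trans (hr v))// -[leRHS]mulr1 ler_wpM2l ?(ltW r0)//.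
by rewrite nrmE lecR.
Qed.

Lemma nrm_le_opnorm f v : continuous f -> nrm (f v) <= opnorm f * nrm v.
Proof.
move=> cf; have [v0|v0] := eqVneq (nrm v) 0.
  by rewrite (nrm_eq0 v0) linear0 nrm0 mulr0.
have vp : 0 < nrm v by rewrite lt_def v0 nrm_ge0.
have nvE : nrm (((nrm v)^-1)%:C%C : R[i]) = (nrm v)^-1.
  by apply: complexI; rewrite -nrmE ger0_norm// ler0c invr_ge0 nrm_ge0.
have : nrm (f (((nrm v)^-1)%:C%C *: v)) <= opnorm f.
  apply: (sup_upper_bound (opnorm_has_sup cf)).
  by exists (((nrm v)^-1)%:C%C *: v) => //=; rewrite nrmZ nvE mulVf.
by rewrite linearZ/= nrmZ nvE mulrC ler_pdivrMr.
Qed.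

Lemma opnorm_le f c : continuous f -> (forall v, nrm v <= 1 -> nrm (f v) <= c) ->
  opnorm f <= c.
Proof.
move=> cf h; apply: ge_sup; first by case: (opnorm_has_sup cf).
by move=> _ [v /= v1 <-]; exact: h.
Qed.

Lemma opnorm_ge0 f : continuous f -> 0 <= opnorm f.
Proof.
move=> cf; rewrite (le_trans (nrm_ge0 (f 0)))//.
apply: (sup_upper_bound (opnorm_has_sup cf)).
by exists 0 => //=; rewrite nrm0.
Qed.

End OperatorNorm.

Section MaximalCompletion.
Context {R : realType}.
Variables (BB : completeNormedModType R[i] -> Prop) (X : bgSpace R).

Definition rep_norms (a : Cu X) : set R :=
  [set r | exists B, BB B /\ exists pi : representation X B, r = opnorm (pi a)].

Definition maxnorm (a : Cu X) : R := sup (rep_norms a).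

Lemma opnorm_le_maxnorm B (pi : representation X B) a :
  BB B -> opnorm (pi a) <= maxnorm a.
Proof.
move=> hB; apply: sup_upper_bound; last by exists B; split=> //; exists pi.
split; first by exists (opnorm (pi a)), B; split=> //; exists pi.
by exists (l1norm a) => _ [C [_ [rho ->]]]; exact: rep_l1norm.
Qed.

Lemma maxnorm_le a c : 0 <= c ->
  (forall B, BB B -> forall pi : representation X B, opnorm (pi a) <= c) ->
  maxnorm a <= c.
Proof.
move=> c0 h; have [e|/set0P ne] := eqVneq (rep_norms a) set0.
  by rewrite /maxnorm e sup0.
by apply: ge_sup => // _ [B [hB [pi ->]]]; exact: h.
Qed.

Lemma maxnorm_ge0 a : 0 <= maxnorm a.
Proof.
have [e|/set0P[_ [B [hB [pi _]]]]] := eqVneq (rep_norms a) set0.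
  by rewrite /maxnorm e sup0.
by rewrite (le_trans _ (opnorm_le_maxnorm pi a hB))// opnorm_ge0//; exact: rep_continuous.
Qed.

Lemma nrm_rep_le B (pi : representation X B) a v :
  BB B -> nrm (pi a v) <= maxnorm a * nrm v.
Proof.
move=> hB; apply: le_trans (nrm_le_opnorm _ (rep_continuous (r := pi) (T := a))) _.
by rewrite ler_wpM2r ?nrm_ge0// opnorm_le_maxnorm.
Qed.

Lemma rep0 B (pi : representation X B) v : pi 0 v = 0.
Proof. by rewrite -(scale0r (0 : Cu X)) repZ scale0r. Qed.

Lemma repN B (pi : representation X B) a v : pi (- a) v = - pi a v.
Proof. by rewrite -scaleN1r repZ scaleN1r. Qed.

Lemma maxnorm0 : maxnorm 0 = 0.
Proof.
apply/eqP; rewrite eq_le maxnorm_ge0 andbT maxnorm_le// => B hB pi.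
by apply: opnorm_le => [|v _]; [exact: rep_continuous|rewrite rep0 nrm0].
Qed.

Lemma maxnormN a : maxnorm (- a) = maxnorm a.
Proof.
congr sup; apply/seteqP; split=> _ [B [hB [pi ->]]]; exists B; split=> //;
  exists pi; congr sup; apply/seteqP; split=> _ [v v1 <-]; exists v => //;
  by rewrite repN nrmN.
Qed.

Lemma maxnormD a b : maxnorm (a + b) <= maxnorm a + maxnorm b.
Proof.
apply: maxnorm_le => [|B hB pi]; first by rewrite addr_ge0// maxnorm_ge0.
apply: opnorm_le => [|v v1]; first exact: rep_continuous.
rewrite repD (le_trans (nrmD _ _))//.
by rewrite lerD// (le_trans (nrm_rep_le _ _ _ hB))// ler_piMr// maxnorm_ge0.
Qed.

Lemma maxnormM a b : maxnorm (a * b) <= maxnorm a * maxnorm b.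
Proof.
apply: maxnorm_le => [|B hB pi]; first by rewrite mulr_ge0// maxnorm_ge0.
apply: opnorm_le => [|v v1]; first exact: rep_continuous.
rewrite repM (le_trans (nrm_rep_le _ _ _ hB))// ler_wpM2l ?maxnorm_ge0//.
by rewrite (le_trans (nrm_rep_le _ _ _ hB))// ler_piMr// maxnorm_ge0.
Qed.

Definition maxseminorm : ringSeminorm R (Cu X) :=
  RingSeminorm maxnorm0 maxnormN maxnormD maxnormM.

Definition C_max : Type := completion maxseminorm.
HB.instance Definition _ := GRing.PzRing.on C_max.

(* The extension by continuity of a representation to C_max. *)
Definition rep_ext (B : completeNormedModType R[i]) (pi : representation X B)
    (p : C_max) : B -> B :=
  fun v => lim (pi (cs_seq (repr (p : completion maxseminorm)) n) v @[n --> \oo]).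

Lemma Re_gt0 (e : R[i]) : 0 < e -> 0 < complex.Re e.
Proof. by rewrite ltcE => /andP[]. Qed.

Lemma nrm_lt_eps (V : normedZmodType R[i]) (w : V) (e : R[i]) :
  0 < e -> nrm w < complex.Re e -> `|w| < e.
Proof. by move=> e0; rewrite nrmE -{2}(RRe_real (gtr0_real e0)) ltcR. Qed.

Lemma rep_null B (pi : representation X B) (u : nat -> Cu X) v (e : R[i]) :
  BB B -> 0 < e -> is_null maxseminorm u ->
  exists n0, forall n, (n0 <= n)%N -> `|pi (u n) v| < e.
Proof.
move=> hB e0 hu; have e0' := Re_gt0 e0.
have vp : 0 < nrm v + 1 by rewrite ltr_wpDl// nrm_ge0.
have [n0 h] := hu _ (divr_gt0 e0' vp); exists n0 => n /h hn.
apply: nrm_lt_eps => //; apply: le_lt_trans (nrm_rep_le _ _ _ hB) _.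
move: hn; rewrite ltr_pdivlMr// => /(le_lt_trans _); apply.
by rewrite ler_wpM2l ?maxnorm_ge0// lerDl.
Qed.

Lemma rep_cvg B (pi : representation X B) (u : cauchySeq maxseminorm) v :
  BB B -> cvg (pi (u n) v @[n --> \oo]).
Proof.
move=> hB; apply: cauchy_cvg; apply: cauchy_exP => e e0.
have e0' := Re_gt0 e0.
have vp : 0 < nrm v + 1 by rewrite ltr_wpDl// nrm_ge0.
have [n0 h] := csP u (divr_gt0 e0' vp).
exists (pi (u n0) v); exists n0 => // n /= hn.
rewrite -ball_normE/=; apply: nrm_lt_eps => //.
rewrite -repN -repD; apply: le_lt_trans (nrm_rep_le _ _ _ hB) _.
have := h n0 n (leqnn _) hn; rewrite ltr_pdivlMr// => /(le_lt_trans _); apply.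
by rewrite ler_wpM2l ?maxnorm_ge0// lerDl.
Qed.

Lemma rep_ext_class B (pi : representation X B) (u : cauchySeq maxseminorm) v :
  BB B -> pi (u n) v @[n --> \oo] --> rep_ext pi (cpl_class u) v.
Proof.
move=> hB; rewrite /rep_ext; set u' := repr _.
have hl := @rep_cvg B pi u' v hB.
have hn : is_null maxseminorm (cs_seq u' - cs_seq u).
  by apply/cpl_classE; exact: reprK.
rewrite -[lim _]subr0.
have -> : (fun n => pi (u n) v) =
    (fun n => pi (u' n) v) - (fun n => pi ((cs_seq u' - cs_seq u) n) v).
  by apply/funext => n; rewrite !fctE repD repN opprB addrC subrK.
apply: cvgB => //; apply/cvgr0Pnorm_lt => e e0.
have [n0 h] := rep_null pi v hB e0 hn.
by exists n0 => // n /= /h.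
Qed.

Lemma rep_ext_to_completion B (pi : representation X B) (a : Cu X) v :
  BB B -> rep_ext pi (to_completion maxseminorm a) v = pi a v.
Proof.
move=> hB.
have h := @rep_ext_class B pi (CauchySeq (cst_cauchy maxseminorm a)) v hB.
rewrite -[LHS](cvg_lim (@norm_hausdorff _ _) h).
have e : (fun n : nat => pi a v) @ \oo --> pi a v by apply: cvg_cst.
apply: cvg_lim => //; exact: norm_hausdorff.
Qed.

End MaximalCompletion.

(* Main.v *)
Require Import Defs.
From HB Require Import structures.
From mathcomp Require Import all_boot all_order all_algebra.
From mathcomp Require Import complex ring lra.
From mathcomp Require Import all_classical all_reals all_analysis.
Set Implicit Arguments.
Unset Strict Implicit.
Unset Printing Implicit Defensive.
Import Order.TTheory GRing.Theory Num.Theory.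
Import numFieldNormedType.Exports.
Local Open Scope classical_set_scope.
Local Open Scope ring_scope.

(* Colouring X so that nearby points get different colours covers E0 by the
   graphs of finitely many involutions s_i of X; their permutation matrices
   sigma_i are partial translations of full range, act by isometries, and their
   common fixed vectors form B^pi.

   (1) => (2): let A be the average of the sigma_i. A spectral gap and uniform
   convexity give, for each v, an invariant w with |A v - w| <= r |v|, where r < 1
   is uniform over all representations; so the powers of A are Cauchy in the
   maximal norm and converge to an idempotent p, and P = pi(p) has range B^pi.
   That P vanishes on B_pi requires P sigma_i = P, of which only the averaged form
   P A = P is clear.  If P (sigma_i u - sigma_j u) were nonzero, an affine random
   walk with linear parts sigma_k and mean zero translations would have linear
   drift under P.  After n steps, two independent halves of the walk of length 2n
   nearly realise equality in the triangle inequality, hence by uniform convexity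
   nearly coincide; being independent, with one of mean zero, they are small,
   a contradiction.

   (2) => (1): representations with worse and worse gaps and almost invariant unit
   vectors in B_pi have an ultraproduct with a nonzero vector v that is killed by
   p, and for which every (V - chi) v with V in E0 is invariant.  Cutting by the
   two halves of the support of s_i, such a vector is invariant and annihilated by
   a partial translation, so it vanishes; thus v is invariant, and p v = v. *)

(* all_analysis has another edist, which shadows the metric of Defs. *)
Local Notation edist := Defs.edist.

(** * Real-valued norms and limits of sequences *)

Section NrmExtra.
Context {R : realType} {V : normedModType R[i]}.
Implicit Types (u : nat -> V) (v w : V).

Lemma nrmB v w : nrm (v - w) = nrm (w - v).
Proof. by rewrite -nrmN opprB. Qed.

Lemma nrm_real (a : R) : nrm (a%:C%C : R[i]) = `|a|.
Proof. by apply: complexI; rewrite -nrmE normc_def/= expr0n/= addr0 sqrtr_sqr. Qed.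

Lemma nrmZr (a : R) v : nrm (a%:C%C *: v) = `|a| * nrm v.
Proof. by rewrite nrmZ nrm_real. Qed.

Lemma nrm_natr n : nrm (n%:R : R[i]) = n%:R.
Proof. by rewrite -(rmorph_nat (real_complex R)) nrm_real normr_nat. Qed.

Lemma nrm_cvgP u v : u n @[n --> \oo] --> v <->
  forall e : R, 0 < e -> exists n0, forall n, (n0 <= n)%N -> nrm (u n - v) < e.
Proof.
split=> [/cvgrPdist_lt h e e0|h].
  have e0' : 0 < e%:C%C by rewrite ltcR.
  have [n0 _ hn] := h _ e0'.
  exists n0 => n hn0; have := hn n hn0.
  by rewrite /= nrmE ltcR nrmB.
apply/cvgrPdist_lt => e e0.
have [n0 hn] := h _ (Re_gt0 e0); exists n0 => // n /= hn0.
by apply: nrm_lt_eps => //; rewrite nrmB; exact: hn.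
Qed.

Lemma nrm_cvg_unique u v w :
  u n @[n --> \oo] --> v -> u n @[n --> \oo] --> w -> v = w.
Proof. by move=> hv hw; exact: (cvg_unique _ hv hw). Qed.

Lemma nrm_le_eps_eq0 v : (forall e : R, 0 < e -> nrm v <= e) -> v = 0.
Proof.
move=> h; apply: nrm_eq0; apply/eqP; rewrite eq_le nrm_ge0 andbT.
by apply/ler_addgt0Pr => e /h; rewrite add0r.
Qed.

Lemma nrm_cvg_le u v c : u n @[n --> \oo] --> v ->
  (exists n0, forall n, (n0 <= n)%N -> nrm (u n) <= c) -> nrm v <= c.
Proof.
move=> /nrm_cvgP h [n0 hc]; apply/ler_addgt0Pr => e /h[n1 hn].
have h1 := hc _ (leq_maxl n0 n1); have h2 := hn _ (leq_maxr n0 n1).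
rewrite -[v](subrK (u (maxn n0 n1))) addrC (le_trans (nrmD _ _))//.
by rewrite lerD// nrmB ltW.
Qed.

End NrmExtra.

Lemma nrm_le_continuous {R : realType} {V W : normedModType R[i]}
    (f : {linear V -> W}) (c : R) :
  (forall v, nrm (f v) <= c * nrm v) -> continuous f.
Proof.
move=> h.
apply/linear_bounded_continuous/linear_boundedP.
exists (Num.max c 0)%:C%C; split; first by rewrite ger0_real// ler0c le_max lexx orbT.
move=> M hM v.
rewrite (le_trans _ (ler_wpM2r (normr_ge0 v) (ltW hM)))//.
rewrite !nrmE -rmorphM/= lecR (le_trans (h v))// ler_wpM2r ?nrm_ge0//.
by rewrite le_max lexx.
Qed.

(** * A quadratic inequality from uniform convexity *)

Section UniformConvexity.
Context {R : realType}.

(** [d] is a real lower bound for the modulus of convexity, so one [d] can serve a whole family. *)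
Definition uniformly_convex_with (d : R -> R) (V : normedModType R[i]) : Prop :=
  forall (t : R) (x y : V), 0 < t <= 2 -> nrm x = 1 -> nrm y = 1 -> t <= nrm (x - y) ->
    nrm (x + y) <= 2 * (1 - d t).

Lemma uniformly_convex_familyP (BB : completeNormedModType R[i] -> Prop) :
  uniformly_convex_family BB ->
  exists2 d : R -> R, (forall t, 0 < t <= 2 -> 0 < d t) &
    forall B, BB B -> uniformly_convex_with d B.
Proof.
move=> h.
pose P t (r : R) := 0 < t <= 2 -> 0 < r /\
    (r%:E <= ereal_inf [set m | exists B, BB B /\ m = convexity_modulus B t])%E.
have [t|d hd] := @choice _ _ P.
  rewrite /P; have [t02|nt] := pselect (0 < t <= 2); last by exists 0.
  have := h t t02; case: ereal_inf => [r r0|_|//].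
    by exists r => _; split; rewrite ?lexx// -lte_fin.
  (* An infimum [+oo] means that no space of the family has such a pair of unit vectors; any
     positive value is then a lower bound. *)
  by exists 1 => _; split; rewrite ?leey.
exists d => [t /hd[]//|B hB t x y t02 x1 y1 txy].
have /le_trans := (hd t t02).2.
have hm : (ereal_inf [set m | exists B, BB B /\ m = convexity_modulus B t] <=
    convexity_modulus B t)%E by apply: ereal_inf_lbound; exists B.
move=> /(_ _ hm) /le_trans => /(_ (1 - nrm (x + y) / 2)%:E).
have -> // : (convexity_modulus B t <= (1 - nrm (x + y) / 2)%:E)%E.
  by apply: ereal_inf_lbound; exists (x, y).
by move=> /(_ isT); rewrite lee_fin; lra.
Qed.

(** The right side is at least [((a + b) ^+ 2 - s ^+ 2) / 4]; factor the difference of squares and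
    use that [b] is at least [3 / 4 * a]. *)
Lemma shrunk_sum_square_le (a b s e : R) : 0 <= b -> b <= a -> a - b <= a / 4 -> 0 < e ->
  0 <= s -> s <= a + b - 2 * b * e ->
  3 / 8 * e * a ^+ 2 <= (a ^+ 2 + b ^+ 2) / 2 - s ^+ 2 / 4.
Proof.
move=> b0 ba near e0 s0 sab.
have be0 : 0 <= b * e by rewrite mulr_ge0// ltW.
have h1 : (2 * b * e) * (a + b) <= (a + b) ^+ 2 - s ^+ 2.
  by rewrite subr_sqr; apply: ler_pM; lra.
have a0 : 0 <= a by lra.
have h2 : 3 / 4 * a * e <= b * e by rewrite ler_pM2r//; lra.
have h3 : 3 / 4 * a * e * a <= b * e * (a + b).
  apply: ler_pM => //; last by lra.
  by apply: mulr_ge0; [lra|exact: ltW].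
have := sqr_ge0 (a - b); rewrite sqrrB sqrrD in h1 *; lra.
Qed.

Section OneSpace.
Variables (V : normedModType R[i]) (d : R -> R).
Hypothesis d_gt0 : forall t, 0 < t <= 2 -> 0 < d t.
Hypothesis dV : uniformly_convex_with d V.
Implicit Types x y : V.

Lemma uniformly_convex_scaled t r x y : 0 < t <= 2 -> 0 <= r -> nrm x = r -> nrm y = r ->
  t * r <= nrm (x - y) -> nrm (x + y) <= 2 * (1 - d t) * r.
Proof.
move=> t02; rewrite le_eqVlt => /predU1P[<- x0 y0 _|r0 xr yr txy].
  by rewrite (nrm_eq0 x0) (nrm_eq0 y0) addr0 nrm0 mulr0.
have sc v : nrm (r^-1%:C%C *: v) = r^-1 * nrm v.
  by rewrite nrmZr gtr0_norm// invr_gt0.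
have := dV (x := r^-1%:C%C *: x) (y := r^-1%:C%C *: y) t02.
rewrite -scalerBr -scalerDr !sc xr yr mulVf ?gt_eqF// => /(_ erefl erefl).
by rewrite ler_pdivlMl// mulrC => /(_ txy); rewrite ler_pdivrMl// [r * _]mulrC.
Qed.

(** The factor of [C] is nonnegative, so only a large [nrm (x - y)] needs work. Either the norms
    differ and strict convexity of the square suffices, or [x] is shrunk to the sphere through [y]
    at small cost and uniform convexity applies at distance 1/4. *)
Lemma quadratic_convexity_le : let C := 16 * 16 + 11 / d (1/4) in
  forall x y, nrm y <= nrm x ->
  nrm (x - y) ^+ 2 <= (nrm x ^+ 2 + nrm y ^+ 2) / 4 +
    C * ((nrm x ^+ 2 + nrm y ^+ 2) / 2 - nrm (x + y) ^+ 2 / 4).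
Proof.
move=> C x y; set a := nrm x; set b := nrm y; set s := nrm (x + y).
set D := nrm (x - y) => ba.
have t4 : 0 < (1/4 : R) <= 2 by lra.
have d0 := d_gt0 t4.
have b0 : 0 <= b by exact: nrm_ge0.
have s0 : 0 <= s by exact: nrm_ge0.
have D0 : 0 <= D by exact: nrm_ge0.
have sab : s <= a + b by exact: nrmD.
have Dab : D <= a + b by rewrite (le_trans (nrmD _ _))// nrmN.
have i0 : 0 < 11 / d (1/4) by rewrite divr_gt0.
have ssq : s ^+ 2 <= (a + b) ^+ 2 by rewrite ler_sqr ?nnegrE// addr_ge0// (le_trans b0).
have Dsq : D ^+ 2 <= (a + b) ^+ 2 by rewrite ler_sqr ?nnegrE// addr_ge0// (le_trans b0).
have br0 : 0 <= (a ^+ 2 + b ^+ 2) / 2 - s ^+ 2 / 4 by nra.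
have [D4|D4] := leP (D ^+ 2) ((a ^+ 2 + b ^+ 2) / 4).
  by rewrite (le_trans D4)// lerDl mulr_ge0// /C addr_ge0// ltW.
have hC1 c : 0 <= c <= C -> c * ((a ^+ 2 + b ^+ 2) / 2 - s ^+ 2 / 4) <=
    (a ^+ 2 + b ^+ 2) / 4 + C * ((a ^+ 2 + b ^+ 2) / 2 - s ^+ 2 / 4).
  by move=> /andP[c0 cC]; rewrite -[leLHS]add0r lerD// ?ler_wpM2r//; nra.
(* In the first case the factor of [C] is at least [(a - b) ^+ 2 / 4], hence at least [a ^+ 2 / 64],
   while [D ^+ 2] is at most [4 * a ^+ 2]; this gives 16 * 16. *)
have [far|near] := leP (a / 4) (a - b).
  apply: le_trans (hC1 (16 * 16) _); last by rewrite /C; lra.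
  by apply: (le_trans Dsq); nra.
have a0 : 0 < a by rewrite lt_def (le_trans b0)// andbT; apply/eqP; lra.
have D2 : a / 2 < D.
  by rewrite -ltr_sqr ?nnegrE//; [nra|rewrite divr_ge0// ltW].
(* Since [D] exceeds [a / 2] and shrinking costs less than [a / 4], the vectors [x'] and [y] of norm
   [b] remain at distance at least [b / 4]. *)
pose x' := (b / a)%:C%C *: x.
have ba0 : 0 <= b / a by rewrite divr_ge0// ltW.
have x'b : nrm x' = b by rewrite nrmZr ger0_norm// -/a mulfVK// gt_eqF.
have xx' : nrm (x - x') <= a - b.
  rewrite /x' -{1}[x]scale1r -scalerBl -(rmorph1 (real_complex R)) -rmorphB/= nrmZr.
  by rewrite ger0_norm ?subr_ge0 ?ler_pdivrMr ?mul1r// mulrBl mul1r -/a mulfVK// gt_eqF.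
have := uniformly_convex_scaled (x := x') (y := y) t4 b0 x'b erefl.
have -> : 1 / 4 * b <= nrm (x' - y).
  have : D <= nrm (x - x') + nrm (x' - y).
    by rewrite /D (_ : x - y = (x - x') + (x' - y)) ?nrmD// addrA subrK.
  by lra.
move=> /(_ isT) s'.
have ss : s <= a + b - 2 * b * d (1/4).
  have : s <= nrm (x - x') + nrm (x' + y).
    by rewrite /s (_ : x + y = (x - x') + (x' + y)) ?nrmD// addrA subrK.
  by lra.
(* [4 * a ^+ 2] is 32/3 times [3 / 8 * a ^+ 2], and 11 exceeds 32/3. *)
apply: le_trans (hC1 (11 / d (1/4)) _); last by rewrite /C; lra.
set e := d (1/4) in d0 ss *.
have key := shrunk_sum_square_le b0 ba (ltW near) d0 s0 ss.
set Z := _ - _ in key *.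
have Ze : 3 / 8 * a ^+ 2 <= Z / e by rewrite ler_pdivlMr// mulrAC.
rewrite mulrAC -mulrA (le_trans Dsq)//.
have aa : (a + b) ^+ 2 <= 4 * a ^+ 2.
  have -> : 4 * a ^+ 2 = (2 * a) ^+ 2 by rewrite exprMn; ring.
  by rewrite ler_sqr ?nnegrE; lra.
rewrite (le_trans aa)//; have := sqr_ge0 a; lra.
Qed.

(** The coefficient 1/4 leaves room: for independent [x] and [y] with equal second moments, one of
    mean zero, the left side averages to at least half of the average of [nrm x ^+ 2 + nrm y ^+ 2],
    so the defect is a fixed share of the second moment. *)
Lemma quadratic_convexity : exists2 C : R, 0 < C & forall x y,
  nrm (x - y) ^+ 2 <= (nrm x ^+ 2 + nrm y ^+ 2) / 4 +
    C * ((nrm x ^+ 2 + nrm y ^+ 2) / 2 - nrm (x + y) ^+ 2 / 4).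
Proof.
exists (16 * 16 + 11 / d (1/4)).
  by rewrite addr_gt0// divr_gt0// d_gt0//; lra.
move=> x y; have [|/ltW] := leP (nrm y) (nrm x); first exact: quadratic_convexity_le.
by move=> /quadratic_convexity_le; rewrite nrmB [y + x]addrC [nrm y ^+ 2 + _]addrC.
Qed.

End OneSpace.
End UniformConvexity.

(** * The Hahn-Banach theorem over the complex numbers *)

Section HahnBanach.
Context {R : realType} {V : normedModType R[i]}.
Implicit Types (x y z : V) (a b t : R) (G : set (V * R)).

(** Real-linear functionals are kept as graphs so that chains are bounded by plain unions;
    single-valuedness follows from the bound by the norm. *)
Let dominated_graph G : Prop :=
  [/\ forall x a y b t, G (x, a) -> G (y, b) -> G (x + t%:C%C *: y, a + t * b)
    & forall x a, G (x, a) -> a <= nrm x].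

Let line z : set (V * R) := [set u | exists t, u = (t%:C%C *: z, t * nrm z)].

Let line_dominated z : dominated_graph (line z).
Proof.
split=> [x a y b t [s [-> ->]] [r [-> ->]]|x a [t [-> ->]]].
  exists (s + t * r); rewrite scalerA -scalerDl rmorphD rmorphM/=.
  by congr pair; ring.
by rewrite nrmZr ler_wpM2r ?nrm_ge0// ler_norm.
Qed.

(** Zorn runs over the sets that are dominated once [line z] is added: this covers the empty chain
    and puts [(z, nrm z)] into the graph found. *)
Lemma maximal_dominated_graph z : exists G,
  [/\ dominated_graph G, G (z, nrm z) &
      forall H, dominated_graph H -> G `<=` H -> H `<=` G].
Proof.
have [|A [hA maxA]] := @Zorn_bigcup _ [set G | dominated_graph (G `|` line z)].
  move=> F hF totF /=.
  (* By totality of the chain, any two points of the union lie in one dominated member. *)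
  have pick u v : ((\bigcup_(X in F) X) `|` line z) u ->
      ((\bigcup_(X in F) X) `|` line z) v ->
      exists2 S, S `<=` ((\bigcup_(X in F) X) `|` line z) /\ dominated_graph S &
        S u /\ S v.
    have sub S : F S -> S `|` line z `<=` ((\bigcup_(X in F) X) `|` line z).
      by move=> FS w [Sw|lw]; [left; exists S|right].
    move=> [[S FS Su]|lu] [[T FT Tv]|lv].
    - have [ST|TS] := totF _ _ FS FT.
        by exists (T `|` line z); split; [exact: sub|exact: hF|left; exact: ST|left].
      by exists (S `|` line z); split; [exact: sub|exact: hF|left|left; exact: TS].
    - by exists (S `|` line z); split; [exact: sub|exact: hF|left|right].
    - by exists (T `|` line z); split; [exact: sub|exact: hF|right|left].
    - by exists (line z); split; [move=> w lw; right|exact: line_dominated| |].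
  split=> [x a y b t hx hy|x a hx].
    by have [S [SU [h _]] [Sx Sy]] := pick _ _ hx hy; apply/SU/h.
  by have [S [_ [_ h]] [Sx _]] := pick _ _ hx hx; exact: h.
exists (A `|` line z); split=> //.
  by right; exists 1; rewrite scale1r mul1r.
move=> H hH AH w Hw; apply: contrapT => nw.
apply: (maxA H).
  split; first by move=> v Av; apply: AH; left.
  by move=> HA; apply: nw; left; exact: HA.
by rewrite /= setUidl// => v lv; apply: AH; right.
Qed.

(** One-dimensional extension: the value at [z] must lie above every [u.2 - nrm (u.1 - z)] and below
    every [nrm (u.1 + z) - u.2]. The supremum of the former works, and maximality puts the extended
    graph [H] back into [G]. *)
Let dominated_graph_total G z : dominated_graph G -> G (0, 0) ->
  (forall H, dominated_graph H -> G `<=` H -> H `<=` G) ->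
  exists a, G (z, a).
Proof.
move=> [lin dom] G00 maxG.
have scale t y b : G (y, b) -> G (t%:C%C *: y, t * b).
  by move=> /(lin _ _ _ _ t G00); rewrite !add0r.
pose S := [set u.2 - nrm (u.1 - z) | u in G].
have Sub u : G u -> ubound S (nrm (u.1 + z) - u.2).
  case: u => x a Gu _ [[y b] Gv <-] /=; rewrite lerBlDr addrAC lerBrDr.
  have := dom _ _ (lin _ _ _ _ 1 Gu Gv).
  rewrite scale1r mul1r [b + a]addrC => /le_trans; apply.
  by rewrite [x + y](_ : _ = (x + z) + (y - z)) ?nrmD// addrACA subrr addr0.
have hasS : has_sup S.
  split; first by exists (0 - nrm (0 - z)), (0, 0).
  by exists (nrm (0 + z) - 0); exact: (Sub _ G00).
pose a := sup S; exists a.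
pose H := [set w : V * R | exists u t, G u /\ w = (u.1 + t%:C%C *: z, u.2 + t * a)].
have upa u : G u -> u.2 + a <= nrm (u.1 + z).
  by move=> Gu; rewrite addrC -lerBrDr; apply: ge_sup; [case: hasS|exact: Sub].
have loa u : G u -> u.2 - a <= nrm (u.1 - z).
  move=> Gu; rewrite lerBlDr addrC -lerBlDr.
  by apply: (sup_upper_bound hasS); exists u.
apply: (maxG H).
- split=> [x b y c t [[x' b'] [s [Gx [-> ->]]]] [[y' c'] [r [Gy [-> ->]]]]|].
    exists (x' + t%:C%C *: y', b' + t * c'), (s + t * r); split; first exact: lin.
    congr pair => /=; last by ring.
    by rewrite rmorphD rmorphM/= scalerDl scalerDr scalerA addrACA.
  move=> x b [[x' b'] [t [Gx [-> ->]]]] /=.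
  (* Scaling by the inverse of [t] or [- t] reduces to the coefficients 1 and -1, that is, to [upa]
     and [loa]. *)
  have [t0|t0|->] := ltrgt0P t; last 1 first.
  - by rewrite scale0r mul0r !addr0; exact: dom.
  - have -> : x' + t%:C%C *: z = t%:C%C *: (t^-1%:C%C *: x' + z).
      by rewrite scalerDr scalerA -rmorphM/= divff ?gt_eqF// scale1r.
    rewrite nrmZr gtr0_norm// -ler_pdivrMl// mulrDr mulrA mulVf ?gt_eqF// mul1r.
    exact: (upa _ (scale t^-1 _ _ Gx)).
  - have -> : x' + t%:C%C *: z = (- t)%:C%C *: ((- t)^-1%:C%C *: x' - z).
      rewrite scalerBr scalerA -rmorphM/= divff ?oppr_eq0 ?lt_eqF// scale1r.
      by rewrite rmorphN/= scaleNr opprK.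
    have nt : 0 < - t by rewrite oppr_gt0.
    rewrite nrmZr gtr0_norm// -ler_pdivrMl// mulrDr mulrA.
    have -> : (- t)^-1 * t = -1 by rewrite invrN mulNr mulVf ?lt_eqF.
    rewrite mulN1r; exact: (loa _ (scale (- t)^-1 _ _ Gx)).
- by move=> [x b] Gx; exists (x, b), 0; rewrite scale0r mul0r !addr0.
- by exists (0, 0), 1; rewrite scale1r mul1r !add0r.
Qed.

Lemma dual_separates_points z : z != 0 ->
  exists2 g : V -> R[i], linear (g : V -> R[i]^o) /\ continuous (g : V -> R[i]^o) &
    g z != 0.
Proof.
move=> z0.
have [G [[lin dom] Gz maxG]] := maximal_dominated_graph z.
have G00 : G (0, 0).
  have := lin _ _ _ _ (-1) Gz Gz.
  by rewrite rmorphN1 scaleN1r mulN1r !subrr.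
have tot x := cid (dominated_graph_total x (conj lin dom) G00 maxG).
pose f x := sval (tot x); have Gf x : G (x, f x) := svalP (tot x).
have uniqG x a b : G (x, a) -> G (x, b) -> a <= b.
  move=> ha hb; have := dom _ _ (lin _ _ _ _ (-1) ha hb).
  by rewrite rmorphN1 scaleN1r mulN1r subrr nrm0 subr_le0.
have fE x a : G (x, a) -> f x = a.
  by move=> ha; apply/eqP; rewrite eq_le !(uniqG x).
have flin x y t : f (x + t%:C%C *: y) = f x + t * f y.
  by apply: fE; exact: lin.
have f0 : f 0 = 0 by exact: fE.
have fD x y : f (x + y) = f x + f y by rewrite -[y]scale1r (flin x y 1) mul1r scale1r.
have fZ t x : f (t%:C%C *: x) = t * f x.
  by rewrite -[_ *: _]add0r flin f0 add0r.
have fle x : `|f x| <= nrm x.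
  rewrite ler_norml dom ?Gf// andbT lerNl.
  by rewrite -mulN1r -fZ -(nrmN x) rmorphN1 scaleN1r; exact: dom.
(* The complex-linear functional with real part [f]; it does not vanish at [z], where its real part
   is [nrm z]. *)
pose g x : R[i]^o := (f x +i* - f ('i%C *: x))%C.
have glin : linear g.
  move=> [s t] x y; rewrite /g.
  have e : (s +i* t)%C *: x = s%:C%C *: x + t%:C%C *: ('i%C *: x).
    rewrite scalerA -scalerDl; congr (_ *: _).
    by apply/eqP; rewrite eq_complex/=; apply/andP; split; apply/eqP; ring.
  have e' : 'i%C *: ((s +i* t)%C *: x) = s%:C%C *: ('i%C *: x) + (- t)%:C%C *: x.
    rewrite !scalerA -scalerDl; congr (_ *: _).
    by apply/eqP; rewrite eq_complex/=; apply/andP; split; apply/eqP; ring.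
  rewrite scalerDr !fD e' e !fD !fZ.
  apply/eqP; rewrite eq_complex/=; apply/andP; split; apply/eqP; ring.
exists g; last first.
  apply: contra_neq z0 => /(congr1 (@complex.Re R)) /=.
  by rewrite (fE _ _ Gz); exact: nrm_eq0.
split=> //.
pose gM := GRing.isLinear.Build R[i] V R[i]^o *:%R g glin.
pose gL : {linear V -> R[i]^o} := HB.pack g gM.
apply: (@nrm_le_continuous _ _ _ gL 2) => v.
have -> : gL v = (f v)%:C%C + (- f ('i%C *: v))%:C%C * 'i%C.
  by apply/eqP; rewrite eq_complex/=; apply/andP; split; apply/eqP; ring.
rewrite (le_trans (nrmD _ _))// nrmM !nrm_real normrN mulrDl !mul1r lerD// ?fle//.
rewrite (le_trans (ler_wpM2r (nrm_ge0 _) (fle _)))// nrmZ.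
have -> : nrm ('i%C : R[i]) = 1.
  by apply: complexI; rewrite -nrmE normc_def/= expr0n expr1n add0r sqrtr1.
by rewrite mul1r mulr1.
Qed.

End HahnBanach.

(** Cauchy-Schwarz against a constant family, by expanding the sum of the squares of
    [n * F j - s]. *)
Lemma sqr_sum_le (R : realFieldType) (I : finType) (F : I -> R) :
  (\sum_i F i) ^+ 2 <= #|I|%:R * \sum_i F i ^+ 2.
Proof.
set n := #|I|%:R; set s := \sum_i F i.
have [I0|I0] := eqVneq #|I| 0%N.
  rewrite /s big1 ?expr0n/= ?mulr_ge0 ?ler0n ?sumr_ge0// => [i _|i _].
    exact: sqr_ge0.
  by have := card0_eq I0 i.
have n0 : 0 < n by rewrite ltr0n lt0n.
have : 0 <= \sum_j (n * F j - s) ^+ 2 by apply: sumr_ge0 => j _; rewrite sqr_ge0.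
have -> : \sum_j (n * F j - s) ^+ 2 = n * (n * \sum_j F j ^+ 2 - s ^+ 2).
  under eq_bigr do rewrite sqrrB exprMn.
  rewrite big_split/= sumrB sumr_const -mulr_sumr.
  have -> : \sum_j n * F j * s *+ 2 = n * s * s *+ 2.
    by rewrite sumrMnl -mulr_suml -mulr_sumr.
  by rewrite -[_ *+ #|I|]mulr_natl -/n; ring.
by rewrite pmulr_rge0// subr_ge0.
Qed.

Lemma expr_lt_eps (R : realType) (r e : R) : 0 <= r < 1 -> 0 < e ->
  exists n0, forall n, (n0 <= n)%N -> r ^+ n < e.
Proof.
move=> /andP[r0 r1] e0.
have : (fun n => r ^+ n) @ \oo --> 0 by apply: cvg_expr; rewrite ger0_norm.
move=> /cvgr0Pnorm_lt/(_ _ e0)[n0 _ h]; exists n0 => n /h/=.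
by rewrite ger0_norm// exprn_ge0.
Qed.

(** * Affine random walks in a uniformly convex space have no drift *)

Section Doubling.
Context {R : realType} {V W : normedModType R[i]}.
Variables (d : R -> R).
Hypothesis d_gt0 : forall t, 0 < t <= 2 -> 0 < d t.
Hypothesis dV : uniformly_convex_with d V.
Variable P : {linear V -> W}.

(* An affine random walk with steps w |-> g i w + w i whose translation parts,
   read before the isometry is applied, have mean zero; P is stationary for the
   linear parts. *)
Definition stationary_walk (I : finType) (g h : I -> {linear V -> V}) (w : I -> V) :=
  [/\ forall i v, h i (g i v) = v, forall i v, g i (h i v) = v,
      forall i v, nrm (g i v) = nrm v,
      \sum_i h i (w i) = 0 & forall v, \sum_i P (g i v) = #|I|%:R *: P v].

(** Two independent consecutive steps become one step indexed by pairs. The mean stays zero because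
    each half vanishes when summed over its own index. *)
Lemma stationary_walk_double (I : finType) (g h : I -> {linear V -> V}) (w : I -> V) :
  stationary_walk g h w ->
  stationary_walk (fun u : I * I => g u.2 \o g u.1) (fun u => h u.1 \o h u.2)
    (fun u => g u.2 (w u.1) + w u.2).
Proof.
move=> [hg gh iso mean0 statP]; split=> [u v|u v|u v||v] /=.
- by rewrite !hg.
- by rewrite !gh.
- by rewrite !iso.
- under eq_bigr do rewrite !linearD hg.
  rewrite big_split/=.
  rewrite -(pair_bigA _ (fun i j => h i (w i))) -(pair_bigA _ (fun i j => h i (h j (w j))))/=.
  under [X in _ + X]eq_bigr do rewrite -linear_sum mean0 linear0.
  rewrite big1_eq addr0 exchange_big/=.
  by under eq_bigr do rewrite mean0; rewrite big1_eq.
- rewrite -(pair_bigA _ (fun i j => P (g j (g i v))))/=.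
  under eq_bigr do rewrite statP.
  by rewrite -scaler_sumr statP scalerA -natrM card_prod.
Qed.

Let second_moment (I : finType) (w : I -> V) := \sum_i nrm (w i) ^+ 2.

(** Moments are plain sums: after division by the number of indices, doubling multiplies the second
    moment by at most [4 * r], less than the factor 4 that a linear drift requires. The rate is
    fixed before the walk, so it serves all iterated doublings. *)
Lemma stationary_walk_moment : exists2 r : R, 0 <= r < 1 &
  forall (I : finType) (g h : I -> {linear V -> V}) (w : I -> V),
  stationary_walk g h w ->
  second_moment (fun u : I * I => g u.2 (w u.1) + w u.2) <=
    4 * r * #|I|%:R * second_moment w.
Proof.
have [C C0 hC] := quadratic_convexity d_gt0 dV.
pose D := Num.max C 1.
(* The rate is read off from the final inequality [n * q / 2 <= D * (n * q - T / 4)]; taking [D] at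
   least 1 keeps it nonnegative. *)
exists (1 - (2 * D)^-1) => [|I g h w [hg gh iso mean0 statP]].
  have D1 : 1 <= D by rewrite le_max lexx orbT.
  have : (2 * D)^-1 <= 1 by rewrite invf_le1; lra.
  have : 0 < (2 * D)^-1 by rewrite invr_gt0; lra.
  by lra.
have D0 : 0 < D by rewrite lt_max C0.
have {}hC (x y : V) : nrm (x - y) ^+ 2 <= (nrm x ^+ 2 + nrm y ^+ 2) / 4 +
    D * ((nrm x ^+ 2 + nrm y ^+ 2) / 2 - nrm (x + y) ^+ 2 / 4).
  apply: (le_trans (hC x y)); rewrite lerD2l ler_wpM2r ?le_max ?lexx//.
  have h1 := nrmD x y; have h2 := nrm_ge0 (x + y).
  have : nrm (x + y) ^+ 2 <= (nrm x + nrm y) ^+ 2.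
    by rewrite ler_sqr ?nnegrE// addr_ge0// nrm_ge0.
  have := sqr_ge0 (nrm x - nrm y); move: (nrm x) (nrm y) (nrm (x + y)) => a b s.
  by rewrite sqrrB sqrrD; lra.
set q := second_moment w; set n := #|I|%:R.
have q0 : 0 <= q by apply: sumr_ge0 => i _; rewrite exprn_ge0// nrm_ge0.
have isoh i v : nrm (h i v) = nrm v by rewrite -[in RHS](gh i v) iso.
pose S := \sum_i \sum_j nrm (w i - h j (w j)) ^+ 2.
pose T := \sum_i \sum_j nrm (w i + h j (w j)) ^+ 2.
(* Applying the isometry [h j] turns the doubled step into [w i + h j (w j)], a sum of independent
   terms whose second one has mean zero. *)
have TE : second_moment (fun u : I * I => g u.2 (w u.1) + w u.2) = T.
  rewrite /second_moment -(pair_bigA _ (fun i j => nrm (g j (w i) + w j) ^+ 2))/=.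
  apply: eq_bigr => i _; apply: eq_bigr => j _.
  by rewrite -(isoh j) linearD hg.
rewrite TE.
have nq : \sum_i \sum_(j : I) nrm (w i) ^+ 2 = n * q.
  under eq_bigr do rewrite sumr_const -mulr_natl.
  by rewrite -mulr_sumr.
have nq' : \sum_(i : I) \sum_j nrm (h j (w j)) ^+ 2 = n * q.
  under eq_bigr do under eq_bigr do rewrite isoh.
  by rewrite sumr_const -mulr_natl.
have hS : S <= (n * q + n * q) / 4 + D * ((n * q + n * q) / 2 - T / 4).
  rewrite -{1 3}nq -nq' /S /T !mulr_suml.
  rewrite -!big_split/= !mulr_suml -sumrB mulr_sumr -big_split/=.
  apply: ler_sum => i _.
  rewrite -!big_split/= !mulr_suml -sumrB mulr_sumr -big_split/=.
  by apply: ler_sum => j _; exact: hC.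
(* Jensen: averaging the second argument to its mean 0 can only decrease S. *)
have qS : n * q <= S.
  rewrite /q /S mulr_sumr; apply: ler_sum => i _.
  have [I0|I0] := eqVneq n 0.
    by rewrite I0 mul0r; apply: sumr_ge0 => j _; rewrite exprn_ge0// nrm_ge0.
  have n0 : 0 < n by rewrite lt_def I0 ler0n.
  pose s := \sum_j nrm (w i - h j (w j)).
  have h1 : n * nrm (w i) <= s.
    rewrite -[n]nrm_natr -nrmZ.
    have -> : #|I|%:R *: w i = \sum_j (w i - h j (w j)).
      by rewrite sumrB mean0 subr0 sumr_const scaler_nat.
    exact: nrm_sum.
  have h2 := sqr_sum_le (fun j => nrm (w i - h j (w j))).
  rewrite -(ler_pM2l n0) (le_trans _ h2)//.
  rewrite mulrA -expr2 -exprMn ler_pXn2r// nnegrE.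
    by rewrite mulr_ge0 ?nrm_ge0// ltW.
  by apply: sumr_ge0 => j _; exact: nrm_ge0.
have : n * q / 2 <= D * (n * q - T / 4) by lra.
rewrite mulrC -ler_pdivrMl//.
have -> : D^-1 * (2^-1 * (n * q)) = (2 * D)^-1 * (n * q) by field; lra.
by set e := (2 * D)^-1; lra.
Qed.

(** By stationarity doubling multiplies the drift by exactly twice the number of indices, whereas
    the bound on its square gains an extra factor [r]; iteration forces the drift to vanish. *)
Lemma stationary_walk_mean0 (c : R) (I : finType) (g h : I -> {linear V -> V})
    (w : I -> V) :
  (forall v, nrm (P v) <= c * nrm v) -> stationary_walk g h w -> \sum_i P (w i) = 0.
Proof.
move=> hP sw; have [r /andP[r0 r1] step] := stationary_walk_moment.
(* The walk is quantified inside because each doubling changes the index set. *)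
have main k : forall (I : finType) (g h : I -> {linear V -> V}) (w : I -> V),
    stationary_walk g h w ->
    nrm (\sum_i P (w i)) ^+ 2 <= c ^+ 2 * #|I|%:R * second_moment w * r ^+ k.
  elim: k => [|k IH] {sw w g h I} I g h w sw.
    rewrite expr0 mulr1 -linear_sum.
    have h1 : nrm (P (\sum_i w i)) ^+ 2 <= (c * nrm (\sum_i w i)) ^+ 2.
      by rewrite ler_sqr ?nnegrE ?nrm_ge0// (le_trans _ (hP _))// nrm_ge0.
    rewrite (le_trans h1)// exprMn -mulrA ler_wpM2l ?sqr_ge0//.
    rewrite (le_trans _ (sqr_sum_le _))// ler_sqr ?nnegrE ?nrm_ge0 ?nrm_sum//.
    by apply: sumr_ge0 => i _; exact: nrm_ge0.
  have [I0|I0] := eqVneq #|I| 0%N.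
    rewrite big1; first by rewrite nrm0 expr0n/= I0 mulr0 !mul0r.
    by move=> i; have := card0_eq I0 i.
  have n0 : 0 < #|I|%:R :> R by rewrite ltr0n lt0n.
  have := IH _ _ _ _ (stationary_walk_double sw).
  have -> : \sum_u P (g u.2 (w u.1) + w u.2) = (2 * #|I|%:R)%:C%C *: \sum_i P (w i).
    rewrite -(pair_bigA _ (fun i j => P (g j (w i) + w j)))/=.
    under eq_bigr do (under eq_bigr do rewrite linearD; rewrite big_split/=).
    case: sw => _ _ _ _ statP; under eq_bigr do rewrite statP.
    rewrite big_split/= -scaler_sumr sumr_const -[X in _ + X]scaler_nat -scalerDl.
    by rewrite rmorphM/= rmorph_nat mulr_natl mulr2n rmorph_nat.
  rewrite nrmZr exprMn ger0_norm ?mulr_ge0 ?ler0n//. rewrite card_prod natrM => h1.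
  have := step _ _ _ _ sw; set q := second_moment w in h1 *.
  set q' := second_moment _ in h1 * => h2.
  set n := #|I|%:R in n0 h1 h2 *; set z := nrm _ in h1 *.
  have h3 : c ^+ 2 * (n * n) * q' * r ^+ k <=
      (2 * n) ^+ 2 * (c ^+ 2 * n * q * r ^+ k.+1).
    have -> : (2 * n) ^+ 2 * (c ^+ 2 * n * q * r ^+ k.+1) =
      c ^+ 2 * (n * n) * (4 * r * n * q) * r ^+ k by rewrite [r ^+ k.+1]exprS; ring.
    by rewrite ler_wpM2r ?exprn_ge0// ler_wpM2l// mulr_ge0 ?sqr_ge0// mulr_ge0// ltW.
  have := le_trans h1 h3; rewrite ler_pM2l// exprn_gt0//; lra.
set K := c ^+ 2 * #|I|%:R * second_moment w.
have K0 : 0 <= K.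
  apply: mulr_ge0; first by rewrite mulr_ge0 ?sqr_ge0 ?ler0n.
  by apply: sumr_ge0 => i _; rewrite exprn_ge0// nrm_ge0.
apply: nrm_eq0; apply/eqP; rewrite -sqrf_eq0 eq_le sqr_ge0 andbT.
apply/ler_addgt0Pr => e e0; rewrite add0r.
have K1 : 0 < K + 1 by lra.
have r01 : 0 <= r < 1 by rewrite r0.
have [k /(_ _ (leqnn _)) hk] := expr_lt_eps r01 (divr_gt0 e0 K1).
rewrite (le_trans (main k _ _ _ _ sw))// -/K.
move: hk; rewrite ltr_pdivlMr// => /ltW; apply: le_trans.
by rewrite mulrC ler_wpM2l ?exprn_ge0//; lra.
Qed.

(** Apply the preceding result to the walk with translation parts [g i v] at [i], [- g j v] at [j]
    and 0 elsewhere: pulled back by [h] they cancel, and the drift is the difference of the two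
    sides. *)
Lemma stationary_invariant (c : R) (I : finType) (g h : I -> {linear V -> V}) (i j : I) v :
  (forall v, nrm (P v) <= c * nrm v) ->
  (forall i v, h i (g i v) = v) -> (forall i v, g i (h i v) = v) ->
  (forall i v, nrm (g i v) = nrm v) ->
  (forall v, \sum_i P (g i v) = #|I|%:R *: P v) ->
  P (g i v) = P (g j v).
Proof.
move=> hP hg gh iso statP; have [->//|ij] := eqVneq i j.
pose u k := if k == i then v else if k == j then - v else 0.
have sum_u (F : I -> {linear V -> V}) : \sum_k F k (u k) = F i v - F j v.
  rewrite (bigD1 i)//= (bigD1 j) 1?eq_sym//= big1 => [|k /andP[ki kj]].
    by rewrite /u eqxx eq_sym (negbTE ij) eqxx addr0 linearN.
  by rewrite /u (negbTE ki) (negbTE kj) linear0.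
have sw : stationary_walk g h (fun k => g k (u k)).
  split=> //; under eq_bigr do rewrite hg.
  by have := sum_u (fun=> idfun); rewrite subrr.
have := stationary_walk_mean0 hP sw.
by rewrite -linear_sum sum_u linearB => /eqP; rewrite subr_eq0 => /eqP.
Qed.
End Doubling.

(** * Colourings from bounded geometry and covers by involutions *)

Section Coloring.
Context {R : realType} {X : bgSpace R}.

Lemma maximal_separated (A : set X) (r : R) : 0 <= r -> exists S : set X,
  [/\ S `<=` A, forall x y, S x -> S y -> (edist x y <= r%:E)%E -> x = y &
      forall x, A x -> exists2 y, S y & (edist x y <= r%:E)%E].
Proof.
move=> r0.
pose P := [set S : set X | S `<=` A /\
  forall x y, S x -> S y -> (edist x y <= r%:E)%E -> x = y].
have [|S [[SA sepS] maxS]] := @Zorn_bigcup _ P.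
  move=> F FP totF; split=> [x [S /FP[SA _] /SA//]|x y [S FS Sx] [T FT Ty]].
  have [ST|TS] := totF _ _ FS FT.
    by have [_ h] := FP _ FT; apply: h => //; exact: ST.
  by have [_ h] := FP _ FS; apply: h => //; exact: TS.
exists S; split=> // x Ax; apply: contrapT => far.
have {}far y : S y -> ~ (edist x y <= r%:E)%E by move=> Sy xy; apply: far; exists y.
apply: (maxS (S `|` [set x])).
  split; first by left.
  move=> /(_ x (or_intror erefl)) /far; apply.
  by rewrite ((Defs.edist_eq0 x x).2 erefl) lee_fin.
split=> [y [/SA//|->//]|y z [Sy|->] [Sz|->]//]; first exact: sepS.
  by rewrite Defs.edist_sym => /far => /(_ Sy).
by move=> /far => /(_ Sz).
Qed.

(** Greedy colouring: each class is a maximal separated subset of the points left over. A point that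
    survives [N.+1] rounds would have a neighbour in every class, hence [N.+1] distinct points in a
    ball with at most [N]. *)
Lemma bounded_geometry_coloring (r : R) : exists (M : nat) (c : X -> 'I_M),
  forall x y, (edist x y <= r%:E)%E -> c x = c y -> x = y.
Proof.
wlog r0 : r / 0 <= r => [wl|].
  have [|M [c h]] := wl (Order.max r 0); first by rewrite le_max lexx orbT.
  exists M, c => x y xy; apply: h; apply: (le_trans xy).
  by rewrite lee_fin le_max lexx.
have [f hf] := choice (fun A => @maximal_separated A r r0).
pose U := fix U k := if k is k'.+1 then U k' `|` f (~` U k') else set0 : set X.
have leU j k : (j <= k)%N -> U j `<=` U k.
  by move=> /subnK <-; elim: (k - j)%N => // n IH x /IH; left.
have [N hN] := @size_eballs R X r.
have cov x : exists k : 'I_N.+1, f (~` U k) x.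
  apply: contrapT => /forallNP nf.
  have nU k : (k <= N.+1)%N -> ~ U k x.
    elim: k => [_ []//|k IH kN [Ux|]]; first exact: IH (ltnW kN) Ux.
    exact: (nf (Ordinal kN)).
  have [k|z hz] := @choice _ _ (fun k z => (k <= N)%N ->
      f (~` U k) z /\ (edist x z <= r%:E)%E).
    have [kN|] := boolP (k <= N)%N; last by exists x.
    have [_ _ h] := hf (~` U k).
    by have [|y fy xy] := h x; [exact: nU (leqW kN)|exists y].
  have zlt j k : (j < k)%N -> (k <= N)%N -> z j <> z k.
    move=> jk kN e; have [h _] := hz _ kN.
    have [+ _ _] := hf (~` U k) => /(_ _ h); apply.
    rewrite -e; apply: (leU j.+1) => //; right.
    by have [] := hz j (ltnW (leq_trans jk kN)).
  have : (size [seq z k | k <- iota 0 N.+1] <= size (eballs x r))%N.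
    apply: uniq_leq_size.
      rewrite map_inj_in_uniq ?iota_uniq// => j k.
      rewrite !mem_iota !add0n !ltnS => /= jN kN e.
      have [jk|jk|//] := ltngtP j k; first by case: (zlt _ _ jk kN).
      by case: (zlt _ _ jk jN).
    move=> y /mapP[k]; rewrite mem_iota add0n ltnS => /= kN ->.
    by apply/mem_eballs; have [] := hz k kN.
  by rewrite size_map size_iota leqNgt ltnS hN.
have [c hc] := choice cov.
exists N.+1, c => x y xy cxy.
have [_ sep _] := hf (~` U (c x)).
by apply: sep => //; rewrite cxy.
Qed.

(** Colours that separate points up to distance [r + r] distinguish the neighbours of a point. For a
    fixed pair of colours each point thus has at most one partner, and swapping partners is an
    involution. [A] collects the first colour of the pair and so splits every swapped pair. *)
Lemma involution_cover (E : set (X * X)) : is_entourage E -> rel_symmetric E ->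
  exists (I : finType) (s : I -> X -> X) (A : I -> set X),
  [/\ forall i, involutive (s i),
      forall i x, s i x <> x -> E (x, s i x) /\ (A i x <-> ~ A i (s i x)),
      forall x y, E (x, y) -> exists i, s i x = y &
      exists i, forall x, s i x = x].
Proof.
move=> [r Er] Esym.
have [M [c hc]] := bounded_geometry_coloring (r + r).
have near x y y' : E (x, y) -> E (x, y') -> c y = c y' -> y = y'.
  move=> /Er/= xy /Er/= xy'; apply: hc.
  by rewrite (le_trans (Defs.edist_triangle _ x _))// EFinD leeD// Defs.edist_sym.
have near' x y : E (x, y) -> c x = c y -> x = y.
  move=> /Er/= xy; apply: hc; apply: (le_trans xy).
  rewrite lee_fin lerDl -lee_fin (le_trans _ xy)// ?Defs.edist_ge0//.
pose T (p : 'I_M * 'I_M) x y := E (x, y) /\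
  ((c x = p.1 /\ c y = p.2) \/ (c x = p.2 /\ c y = p.1)).
have Tsym p x y : T p x y -> T p y x.
  by move=> [/Esym Eyx [[]|[]]]; split=> //; [right|left].
have Tfun p x y y' : T p x y -> T p x y' -> y = y'.
  move=> [Exy h] [Exy' h']; apply: near Exy Exy' _.
  by case: h h' => -[h1 h2] [[h1' h2']|[h1' h2']]; congruence.
pose s o x := if o is Some p then
  if pselect (exists y, T p x y) is left h then sval (cid h) else x else x.
have sT p x y : T p x y -> s (Some p) x = y.
  move=> xy; rewrite /s; case: pselect => [h|[]]; last by exists y.
  exact: Tfun (svalP (cid h)) xy.
have sP p x : s (Some p) x = x \/ T p x (s (Some p) x).
  rewrite /s; case: pselect => [h|]; last by left.
  by right; exact: svalP (cid h).
(* [None] is the identity, whose term in the average of the permutations is later played off against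
   a vector that moves. *)
exists (option ('I_M * 'I_M)), s,
  (fun o => if o is Some p then [set x | c x = p.1] else set0); split.
- move=> [p|//] x; have [h|h] := sP p x; first by rewrite !h.
  by apply: sT; exact: Tsym.
- move=> [p|//] x ne; have [//|h] := sP p x.
  have cne : c x <> c (s (Some p) x).
    by move=> /(near' _ _ h.1) /esym.
  split; first exact: h.1.
  case: h => _ [[h1 h2]|[h1 h2]]; split=> h3.
  - by move=> h4; apply: cne; exact: etrans h1 (esym h4).
  - exact: h1.
  - by case: cne; exact: etrans h3 (esym h2).
  - by case: h3; exact: h2.
- by move=> x y Exy; exists (Some (c x, c y)); apply: sT; split=> //; left.
- by exists None.
Qed.

End Coloring.

(** * Matrix calculus of partial translations *)

Section Translations.
Context {R : realType} {X : bgSpace R}.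
Implicit Types (S T V : Cu X) (A B : set X) (s : X -> X).

Lemma Cu_sumE (I : finType) (F : I -> Cu X) x y : (\sum_i F i) x y = \sum_i F i x y.
Proof. by elim/big_ind2: _ => // S a T b <- <-. Qed.

Lemma chiE A x y : chi A x y = if x == y then indicator A x else 0.
Proof. by []. Qed.

Lemma chi_mull A T x y : (chi A * T) x y = if x \in A then T x y else 0.
Proof.
rewrite [LHS]mat_diag_mull /indicator.
by case: ifP => _; rewrite ?mul1r ?mul0r.
Qed.

Lemma Cu_oneE x y : (1 : Cu X) x y = if x == y then 1 else 0.
Proof. by []. Qed.

Definition bounded_displacement s : Prop :=
  exists r : R, forall x, (edist x (s x) <= r%:E)%E.

Lemma translation_in s : bounded_displacement s ->
  in_Cu (fun x y => if s x == y then 1 else 0).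
Proof.
move=> [r hr]; split.
  by exists 1 => x y; case: ifP => _; [rewrite /nrm normr1|rewrite nrm0].
by exists r => -[x y]; rewrite /supp/=; case: (s x =P y) => [<- _|_ /eqP//]; exact: hr.
Qed.

Definition translation s (hs : bounded_displacement s) : Cu X :=
  Cu_of (translation_in hs).

Lemma translationE s (hs : bounded_displacement s) x y :
  translation hs x y = if s x == y then 1 else 0.
Proof. by []. Qed.

Lemma translation_mull s (hs : bounded_displacement s) T x y :
  (translation hs * T) x y = T (s x) y.
Proof.
rewrite -[LHS]/(mat_mul (translation hs) T x y) /mat_mul.
rewrite -(@fsbig_widen _ _ _ _ [set s x] [set: X])//.
  by rewrite fsbig_set1 translationE eqxx mul1r.
move=> z [_ /= hz]; rewrite ifN ?mul0r//.
by apply/eqP => e; apply: hz.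
Qed.

Lemma translationK s (hs : bounded_displacement s) :
  involutive s -> translation hs * translation hs = 1.
Proof.
move=> sK; apply: Cu_ext => x y; rewrite translation_mull. by rewrite translationE sK.
Qed.

Lemma chi_translation s (hs : bounded_displacement s) A : involutive s ->
  chi A * translation hs = translation hs * chi (s @^-1` A).
Proof.
move=> sK; apply: Cu_ext => x y; rewrite chi_mull translation_mull chiE translationE.
rewrite /indicator.
have -> : (s x \in s @^-1` A) = (x \in A).
  by apply/idP/idP; rewrite !inE /preimage/= sK.
by case: ifP; case: ifP.
Qed.

Lemma pt_rangeP V x : partial_translation V ->
  pt_range V x <-> exists y, V x y != 0.
Proof.
move=> [V01 _ _]; split=> -[y Vxy]; exists y; first by rewrite Vxy oner_neq0.
by case: (V01 x y) Vxy => -> //; rewrite eqxx.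
Qed.

Lemma pt_neq0 V x y : partial_translation V -> V x y != 0 -> V x y = 1.
Proof. by move=> [V01 _ _]; case: (V01 x y) => -> //; rewrite eqxx. Qed.

Lemma pt_row V x y z : partial_translation V -> V x y != 0 ->
  V x z = if y == z then 1 else 0.
Proof.
move=> ptV Vxy; case: eqP => [<-|ne]; first exact: pt_neq0.
have [V01 row _] := ptV.
by case: (V01 x z) => // e; case: ne; apply: row Vxy _; rewrite e oner_neq0.
Qed.

Lemma pt_chi A : partial_translation (chi A).
Proof.
split=> [x y|x y y'|x x' y]; rewrite ?chiE /indicator.
- by case: eqP => _; [case: ifP => _; [right|left]|left].
- by case: (x =P y) => [<-|_ /eqP//]; case: (x =P y') => [<-//|_ _ /eqP].
- by case: (x =P y) => [->|_ /eqP//]; case: (x' =P y) => [->//|_ _ /eqP].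
Qed.

Lemma pt_range_chi A : pt_range (chi A) = A.
Proof.
apply/seteqP; split=> x /=.
  case=> y; rewrite chiE /indicator; case: ifP => [_|_ /eqP]; last by rewrite eq_sym oner_eq0.
  by case: ifP => [/set_mem//|_ /eqP]; rewrite eq_sym oner_eq0.
by move=> Ax; exists x; rewrite chiE eqxx /indicator mem_set.
Qed.

Lemma chiT : chi [set: X] = 1 :> Cu X.
Proof. by apply: Cu_ext => x y; rewrite chiE Cu_oneE /indicator in_setT. Qed.

Lemma pt_chi_mul A V : partial_translation V -> partial_translation (chi A * V).
Proof.
move=> [V01 row col]; split=> [x y|x y y'|x x' y]; rewrite !chi_mull.
- by case: ifP => _; [exact: V01|left].
- by case: ifP => [_|_ /eqP//]; exact: row.
- by case: ifP => [_|_ /eqP//]; case: ifP => [_|_ _ /eqP//]; exact: col.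
Qed.

Lemma pt_range_chi_mul A V : pt_range (chi A * V) = A `&` pt_range V.
Proof.
apply/seteqP; split=> x /=.
  case=> y; rewrite chi_mull; case: ifP => [/set_mem Ax Vxy|_ /eqP].
    by split=> //; exists y.
  by rewrite eq_sym oner_eq0.
by case=> Ax [y Vxy]; exists y; rewrite chi_mull mem_set.
Qed.

Section Involution.
Variables (s : X -> X) (hs : bounded_displacement s).
Hypothesis sK : involutive s.

Lemma pt_translation_mul V :
  partial_translation V -> partial_translation (translation hs * V).
Proof.
move=> [V01 row col]; split=> [x y|x y y'|x x' y]; rewrite !translation_mull//.
- exact: row.
- by move=> h h'; apply: (can_inj sK); exact: col h h'.
Qed.

Lemma pt_range_translation_mul V :
  pt_range (translation hs * V) = s @^-1` (pt_range V).
Proof.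
by apply/seteqP; split=> x /= [y]; rewrite ?translation_mull => h; exists y;
  rewrite ?translation_mull.
Qed.

Lemma pt_one : partial_translation (1 : Cu X).
Proof. by rewrite -chiT; exact: pt_chi. Qed.

Lemma pt_range_one : pt_range (1 : Cu X) = setT.
Proof. by rewrite -chiT pt_range_chi. Qed.

Lemma pt_translation : partial_translation (translation hs).
Proof. by rewrite -[translation hs]mulr1; apply: pt_translation_mul; exact: pt_one. Qed.

Lemma pt_range_translation : pt_range (translation hs) = setT.
Proof.
by rewrite -[translation hs]mulr1 pt_range_translation_mul pt_range_one.
Qed.

Lemma translation_adj : Cu_adj (translation hs) = translation hs.
Proof.
apply: Cu_ext => x y; rewrite -[LHS]/(conjc (translation hs y x)) !translationE.
rewrite (can2_eq sK sK) [y == _]eq_sym.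
by case: ifP => _; rewrite ?conjc1 ?conjc0.
Qed.

End Involution.

Lemma chi_adj A : Cu_adj (chi A) = chi A.
Proof.
apply: Cu_ext => x y; rewrite -[LHS]/(conjc (chi A y x)) !chiE eq_sym.
by case: eqP => [->|_]; rewrite ?conjc0// /indicator; case: ifP; rewrite ?conjc1 ?conjc0.
Qed.

Lemma Cu_adjM S T : Cu_adj (S * T) = Cu_adj T * Cu_adj S.
Proof.
apply: Cu_ext => x y.
rewrite -[LHS]/(conjc (mat_mul S T y x)) -[RHS]/(mat_mul (Cu_adj T) (Cu_adj S) x y).
have [_ [r [_ _ hr]]] := in_Cu_data (CuP (Cu_adj T)).
rewrite (mat_mulE _ _ _ hr).
have h z : S y z * T z x != 0 -> eball x r z.
  by rewrite mulf_eq0 negb_or => /andP[_ Tzx]; apply: hr; rewrite conjc_eq0.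
rewrite /mat_mul (ball_sum h) rmorph_sum/=; apply: eq_bigr => z _.
by rewrite rmorphM mulrC.
Qed.

Lemma Cu_adjD S T : Cu_adj (S + T) = Cu_adj S + Cu_adj T.
Proof. by apply: Cu_ext => x y; exact: rmorphD. Qed.

Lemma Cu_adjN T : Cu_adj (- T) = - Cu_adj T.
Proof. by apply: Cu_ext => x y; exact: rmorphN. Qed.

(** Used for the matrices that kill a given vector and for those whose adjoints are killed on
    composing with a projection. *)
Definition left_ideal (J : set (Cu X)) : Prop :=
  [/\ J 0, forall S T, J S -> J T -> J (S + T) & forall S T, J T -> J (S * T)].

Section Cover.
Variables (E : set (X * X)) (I : finType) (s : I -> X -> X).
Hypothesis hs : forall i, bounded_displacement (s i).
Hypothesis sK : forall i, involutive (s i).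
Hypothesis s_cover : forall x y, E (x, y) -> exists i, s i x = y.

Let sigma i := translation (hs i).

(** Rows outside the range of [V] vanish on both sides, so the range may be cut by the values of
    [k]. *)
Lemma partition_range V (k : X -> I) : partial_translation V ->
  forall F : I -> Cu X,
  (forall x y, pt_range V x -> (V - chi (pt_range V)) x y = F (k x) x y) ->
  V - chi (pt_range V) = \sum_i chi [set x | pt_range V x /\ k x = i] * F i.
Proof.
move=> ptV F hF; apply: Cu_ext => x y; rewrite Cu_sumE.
have [Rx|nRx] := pselect (pt_range V x).
  rewrite hF// (bigD1 (k x))// chi_mull mem_set// big1 => [|i /eqP ne].
    by rewrite /= addr0.
  by rewrite chi_mull memNset// => -[_ /esym].
rewrite big1 => [|i _]; last by rewrite chi_mull memNset// => -[].
rewrite -[LHS]/(V x y - chi (pt_range V) x y) chiE /indicator memNset//.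
have -> : V x y = 0.
  by apply/eqP; apply: contra_notT nRx => Vxy; apply/pt_rangeP => //; exists y.
by rewrite if_same subr0.
Qed.

Lemma pt_generated V (i0 : I) : partial_translation V -> supp V `<=` E ->
  exists B : I -> set X, V - chi (pt_range V) = \sum_i chi (B i) * (sigma i - 1).
Proof.
move=> ptV VE.
have [x|k hk] := @choice _ _ (fun x i => forall y, V x y != 0 -> s i x = y).
  have [[y Vxy]|nV] := pselect (exists y, V x y != 0); last first.
    by exists i0 => y Vxy; case: nV; exists y.
  have [i six] := s_cover (VE (x, y) Vxy); exists i => z Vxz.
  by have [_ row _] := ptV; rewrite six; exact: row Vxy Vxz.
exists (fun i => [set x | pt_range V x /\ k x = i]).
apply: (partition_range ptV) => x y Rx.
have [z Vxz] := (pt_rangeP x ptV).1 Rx.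
rewrite -[LHS]/(V x y - chi (pt_range V) x y).
rewrite -[RHS]/(sigma (k x) x y - (1 : Cu X) x y) Cu_oneE chiE /indicator mem_set//.
by rewrite (pt_row _ ptV Vxz) /sigma translationE (hk _ _ Vxz).
Qed.

(** Induction on the power of [E] containing the support, peeling off the first step of each path:
    that step is some [s i], and the rows are grouped by it. In the base case [V] is diagonal and
    equals [chi (pt_range V)]. *)
Lemma pt_left_ideal (J : set (Cu X)) (i0 : I) : generating E -> left_ideal J ->
  (forall i, J (sigma i - 1)) ->
  forall V, partial_translation V -> J (V - chi (pt_range V)).
Proof.
move=> [_ genE] [J0 JD JM] Js V ptV.
have [n [_ Vn]] := genE _ (CuP V).2.
elim: n V ptV Vn => [|n IH] V ptV Vn.
  suff -> : V = chi (pt_range V) by rewrite pt_range_chi subrr.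
  apply: Cu_ext => x y; rewrite chiE; case: eqP => [<-|ne].
    rewrite /indicator; case: ifP => [/set_mem/(pt_rangeP x ptV)[z Vxz]|/negbT/negP nR].
      by have /= := Vn (x, z) Vxz; rewrite /rel_diag/= => e; rewrite (pt_row _ ptV Vxz) e eqxx.
    apply/eqP; apply: contra_notT nR => Vxx; rewrite mem_set//.
    by apply/pt_rangeP => //; exists x.
  by apply/eqP; apply: contra_notT ne => Vxy; exact: (Vn (x, y) Vxy).
have [x|k hk] := @choice _ _
  (fun x i => forall y, V x y != 0 -> rel_iter E n (s i x, y)).
  have [[y Vxy]|nV] := pselect (exists y, V x y != 0); last first.
    by exists i0 => y Vxy; case: nV; exists y.
  have [z [/= /s_cover[i six] zy]] := Vn (x, y) Vxy; exists i => w Vxw.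
  have [_ row _] := ptV; rewrite six -(row _ _ _ Vxy Vxw)//.
rewrite (partition_range ptV (k := k) (F := fun=> V - 1)); last first.
  move=> x y Rx; rewrite -[LHS]/(V x y - chi (pt_range V) x y).
  by rewrite -[RHS]/(V x y - (1 : Cu X) x y) Cu_oneE chiE /indicator mem_set.
elim/big_ind: _ => // i _; set B := [set x | _].
(* [V'] starts after the first step, so its support lies in the [n]-th iterate of [E]. *)
pose V' := sigma i * (chi B * V).
have ptV' : partial_translation V'.
  by apply: pt_translation_mul => //; exact: pt_chi_mul.
have RV' : pt_range V' = s i @^-1` B.
  by rewrite pt_range_translation_mul pt_range_chi_mul setIidl// => x [].
have -> : chi B * (V - 1) = sigma i * (V' - chi (pt_range V')) + chi B * (sigma i - 1).
  rewrite RV' !mulrBr !mulr1 -(chi_translation (hs i) B (sK i)) /V' /sigma.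
  by rewrite [translation _ * (translation _ * _)]mulrA translationK// mul1r addrA subrK.
apply: JD; last exact: JM.
apply: JM; apply: IH => // -[x y] Vxy.
have {Vxy} : V' x y != 0 by exact: Vxy.
rewrite translation_mull chi_mull.
case: ifP => [/set_mem[_ ksx] /hk|_ /eqP//].
by rewrite ksx sK.
Qed.

End Cover.
End Translations.

(** * Invariant vectors and the norm of the quotient by them *)

Section Representations.
Context {R : realType} {X : bgSpace R} {B : completeNormedModType R[i]}.
Variable pi : representation X B.
Implicit Types (S T V : Cu X) (v w : B).

Lemma repB S T v : pi (S - T) v = pi S v - pi T v.
Proof. by rewrite repD repN. Qed.

Lemma rep_sum (I : finType) (F : I -> Cu X) v : pi (\sum_i F i) v = \sum_i pi (F i) v.
Proof.
by elim/big_ind2: _ => [|S a T b <- <-|//]; [rewrite rep0|rewrite repD].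
Qed.

Lemma l1norm_partial_translation V : partial_translation V -> l1norm V <= 1.
Proof.
move=> ptV.
have s1 : supnorm (1 : Cu X) <= 1.
  (* For empty [X] the supremum takes its default value 0. *)
  have [e|/set0P ne] := eqVneq [set nrm ((1 : Cu X) x x) | x in [set: X]] set0.
    by rewrite /supnorm e sup0.
  apply: ge_sup => // _ [x _ <-].
  by rewrite Cu_oneE eqxx /nrm normr1.
apply: le_trans s1; apply: ge_inf.
  exists 0 => _ [n [f [W [_ _ _ ->]]]]; apply: sumr_ge0 => i _.
  rewrite /supnorm; set A := [set _ | _ in _].
  have [hA|nA] := pselect (has_sup A); last by rewrite sup_out.
  have [[a Aa] _] := hA; apply: le_trans (sup_upper_bound hA Aa).
  by case: Aa => x _ <-; exact: nrm_ge0.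
exists 1%N, (fun=> 1), (fun=> V); split=> //.
- move=> _ x y xy; rewrite Cu_oneE ifN//.
- by rewrite big_ord1 mul1r.
- by rewrite big_ord1.
Qed.

Lemma nrm_rep_l1norm T v : nrm (pi T v) <= l1norm T * nrm v.
Proof.
apply: le_trans (nrm_le_opnorm _ (rep_continuous (r := pi) (T := T))) _.
by rewrite ler_wpM2r ?nrm_ge0// rep_l1norm.
Qed.

Lemma nrm_partial_translation V v : partial_translation V -> nrm (pi V v) <= nrm v.
Proof.
move=> ptV; rewrite (le_trans (nrm_rep_l1norm _ _))// ler_piMl ?nrm_ge0//.
exact: l1norm_partial_translation.
Qed.

Lemma rep_inv0 : rep_inv pi 0.
Proof. by move=> V _; rewrite !linear0. Qed.

Lemma rep_invD v w : rep_inv pi v -> rep_inv pi w -> rep_inv pi (v + w).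
Proof. by move=> hv hw V ptV; rewrite !linearD/= (hv V ptV) (hw V ptV). Qed.

Lemma rep_invZ a v : rep_inv pi v -> rep_inv pi (a *: v).
Proof. by move=> hv V ptV; rewrite !linearZ/= (hv V ptV). Qed.

(** Partial translations act as contractions, so the failure of invariance is at most twice the
    distance to the invariant vectors. *)
Lemma rep_inv_closed v :
  (forall e : R, 0 < e -> exists2 w, rep_inv pi w & nrm (v - w) <= e) -> rep_inv pi v.
Proof.
move=> h V ptV; apply/eqP; rewrite -subr_eq0; apply/eqP/nrm_le_eps_eq0 => e e0.
have [w hw vw] := h (e / 2) (divr_gt0 e0 (ltr0n _ 2)).
have -> : pi V v - pi (chi (pt_range V)) v =
    pi V (v - w) - pi (chi (pt_range V)) (v - w).
  by rewrite (linearB (pi V)) (linearB (pi (chi _))) (hw V ptV) opprB addrA subrK.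
rewrite (le_trans (nrmD _ _))// nrmN [leRHS]splitr lerD//.
  by rewrite (le_trans (nrm_partial_translation _ ptV)).
by rewrite (le_trans (nrm_partial_translation _ (pt_chi _))).
Qed.

Lemma rep_inv_fixed V w : partial_translation V -> pt_range V = setT ->
  rep_inv pi w -> pi V w = w.
Proof. by move=> ptV VT /(_ V ptV); rewrite VT chiT rep1. Qed.

Lemma rep_annihilator_left_ideal v : left_ideal [set T | pi T v = 0].
Proof.
split=> [|S T /= hS hT|S T /= hT]; first exact: rep0.
  by rewrite repD hS hT addr0.
by rewrite repM hT linear0.
Qed.

Lemma quot_nrm_le (w v : B) : rep_inv pi w -> quot_nrm (rep_inv pi) v <= nrm (v - w).
Proof.
move=> hw; apply: ge_inf; last by exists w.
by exists 0 => _ [u _ <-]; exact: nrm_ge0.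
Qed.

Lemma quot_nrm_ge (c : R) v : (forall w, rep_inv pi w -> c <= nrm (v - w)) ->
  c <= quot_nrm (rep_inv pi) v.
Proof.
move=> h; apply: lb_le_inf; first by exists (nrm (v - 0)), 0 => //; exact: rep_inv0.
by move=> _ [w hw <-]; exact: h.
Qed.

Lemma quot_nrm_lt v (c : R) : quot_nrm (rep_inv pi) v < c ->
  exists2 w, rep_inv pi w & nrm (v - w) < c.
Proof.
move=> vc; apply: contrapT => h; move: vc; apply/negP; rewrite -leNgt.
apply: quot_nrm_ge => w hw; rewrite leNgt; apply/negP => vw.
by apply: h; exists w.
Qed.

Lemma quot_nrmZ (a : R) v : 0 < a ->
  quot_nrm (rep_inv pi) (a%:C%C *: v) = a * quot_nrm (rep_inv pi) v.
Proof.
(* Used for [a] and for its inverse, this yields both inequalities. *)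
have half (b : R) u : 0 < b ->
    b * quot_nrm (rep_inv pi) u <= quot_nrm (rep_inv pi) (b%:C%C *: u).
  move=> b0; apply: quot_nrm_ge => w hw.
  have -> : b%:C%C *: u - w = b%:C%C *: (u - b^-1%:C%C *: w).
    by rewrite scalerBr scalerA -rmorphM/= divff ?gt_eqF// scale1r.
  by rewrite nrmZr gtr0_norm// ler_pM2l// quot_nrm_le//; exact: rep_invZ.
move=> a0; apply/eqP; rewrite eq_le half// andbT.
rewrite -ler_pdivrMl//.
have := half a^-1 (a%:C%C *: v); rewrite invr_gt0 => /(_ a0).
by rewrite scalerA -rmorphM/= mulVf ?gt_eqF// scale1r.
Qed.

End Representations.

(** * Uniform estimates for the extension to the maximal completion *)

Section Extension.
Context {R : realType}.
Variables (BB : completeNormedModType R[i] -> Prop) (X : bgSpace R).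
Implicit Types (p : C_max BB X) (B : completeNormedModType R[i]).

Lemma rep_ext_linear p B (pi : representation X B) : BB B -> linear (rep_ext pi p).
Proof.
move=> hB; elim/(@cpl_ind _ _ (maxseminorm BB X)) : p => u a v w.
have h := @rep_ext_class _ BB X B pi u (a *: v + w) hB.
have h' : pi (u n) (a *: v + w) @[n --> \oo] -->
    a *: rep_ext pi (cpl_class u) v + rep_ext pi (cpl_class u) w.
  under eq_fun do rewrite linearD linearZ/=.
  apply: cvgD; last exact: rep_ext_class.
  by apply: cvgZr; exact: rep_ext_class.
exact: nrm_cvg_unique h h'.
Qed.

(** A Cauchy bound in the maximal norm holds in all representations at once. This uniformity later
    allows a matrix to replace [p] in an ultraproduct. *)
Lemma rep_ext_near (u : cauchySeq (maxseminorm BB X)) (e : R) : 0 < e ->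
  exists n0, forall n, (n0 <= n)%N -> forall B (pi : representation X B) v, BB B ->
    nrm (pi (u n) v - rep_ext pi (cpl_class u) v) <= e * nrm v.
Proof.
move=> e0; have [n0 h] := csP u e0; exists n0 => n n0n B pi v hB.
have c : pi (u n) v - pi (u m) v @[m --> \oo] -->
    pi (u n) v - rep_ext pi (cpl_class u) v.
  by apply: cvgB; [exact: cvg_cst|exact: rep_ext_class].
apply: (nrm_cvg_le c); exists n0 => m n0m.
rewrite -repB (le_trans (nrm_rep_le _ _ _ hB))// ler_wpM2r ?nrm_ge0// ltW//.
exact: h.
Qed.

Lemma rep_ext_bounded p : exists2 K : R, 0 <= K &
  forall B (pi : representation X B) v, BB B -> nrm (rep_ext pi p v) <= K * nrm v.
Proof.
elim/(@cpl_ind _ _ (maxseminorm BB X)) : p => u.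
have [n0 h] := rep_ext_near u ltr01.
exists (maxnorm BB (u n0) + 1) => [|B pi v hB]; first by rewrite addr_ge0// maxnorm_ge0.
have := h n0 (leqnn _) B pi v hB; rewrite mul1r => h1.
rewrite -[rep_ext _ _ _](subrK (pi (u n0) v)) (le_trans (nrmD _ _))//.
by rewrite mulrDl mul1r addrC nrmB lerD// nrm_rep_le.
Qed.

End Extension.

(** * From the spectral gap to the idempotent *)

Section SpectralGapProjection.
Context {R : realType}.
Variables (BB : completeNormedModType R[i] -> Prop) (X : bgSpace R).
Variables (d : R -> R).
Hypothesis d_gt0 : forall t, 0 < t <= 2 -> 0 < d t.
Hypothesis dBB : forall B, BB B -> uniformly_convex_with d B.
Variables (E : set (X * X)) (I : finType) (s : I -> X -> X) (i0 : I).
Hypothesis E_generating : generating E.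
Hypothesis hs : forall i, bounded_displacement (s i).
Hypothesis sK : forall i, involutive (s i).
Hypothesis s_cover : forall x y, E (x, y) -> exists i, s i x = y.
Hypothesis s_i0 : forall x, s i0 x = x.
Variable c : R.
Hypothesis c_gt0 : 0 < c.
Hypothesis gap : forall B, BB B -> forall pi : representation X B, has_spectral_gap pi E c.

Let sigma i : Cu X := translation (hs i).
Let N : R := #|I|%:R.

Let N_gt0 : 0 < N.
Proof. by rewrite ltr0n; apply/card_gt0P; exists i0. Qed.

Let mean : Cu X := (N^-1)%:C%C *: \sum_i sigma i.

(** The relative displacement that the gap forces on some [sigma i]. The 4 makes the comparison of
    sums in [mean_step] strict; the cap 2 keeps [t] where [d] is positive. *)
Let t : R := Num.min (c / (4 * N)) 2.

Let t02 : 0 < t <= 2.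
Proof. by rewrite /t lt_min ge_min lexx orbT andbT divr_gt0 ?mulr_gt0/=. Qed.

(** 1/2 serves vectors close to an invariant one; the other term comes from averaging [N] vectors of
    equal norm, two of which lose [2 * d t] of their joint length. *)
Let rate : R := Num.max (1/2) (1 - 2 * d t / N).

Let rate01 : 0 <= rate < 1.
Proof.
have := d_gt0 t02 => dt; have h : 0 < 2 * d t / N by rewrite divr_gt0// mulr_gt0.
by rewrite /rate le_max gt_max; apply/andP; split; [apply/orP; left|apply/andP; split]; lra.
Qed.

Section OneRepresentation.
Context {B : completeNormedModType R[i]}.
Variable pi : representation X B.
Implicit Types (v w : B).

Lemma pt_sigma i : partial_translation (sigma i).
Proof. exact: pt_translation. Qed.

Lemma sigmaK i v : pi (sigma i) (pi (sigma i) v) = v.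
Proof. by rewrite -repM translationK// rep1. Qed.

Lemma nrm_sigma i v : nrm (pi (sigma i) v) = nrm v.
Proof.
apply/eqP; rewrite eq_le (nrm_partial_translation _ _ (pt_sigma i))/=.
by rewrite -{1}[v](sigmaK i) (nrm_partial_translation _ _ (pt_sigma i)).
Qed.

Lemma sigma_i0 v : pi (sigma i0) v = v.
Proof.
rewrite -[RHS](rep1 pi); congr (pi _ _); apply: Cu_ext => x y.
by rewrite translationE s_i0.
Qed.

Lemma sigma_inv i w : rep_inv pi w -> pi (sigma i) w = w.
Proof. by apply: rep_inv_fixed; [exact: pt_sigma|exact: pt_range_translation]. Qed.

Lemma meanE v : pi mean v = (N^-1)%:C%C *: \sum_i pi (sigma i) v.
Proof. by rewrite repZ rep_sum. Qed.

Lemma nrm_mean v : nrm (pi mean v) <= nrm v.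
Proof.
rewrite meanE nrmZr gtr0_norm ?invr_gt0// ler_pdivrMl//.
rewrite (le_trans (nrm_sum _ _))//.
under eq_bigr do rewrite nrm_sigma.
by rewrite sumr_const -mulr_natl.
Qed.

Lemma mean_inv w : rep_inv pi w -> pi mean w = w.
Proof.
move=> hw; rewrite meanE; under eq_bigr do rewrite sigma_inv//.
rewrite sumr_const -scaler_nat scalerA -(rmorph_nat (real_complex R)) -rmorphM/=.
by rewrite mulVf ?gt_eqF// scale1r.
Qed.

Lemma pow_inv n w : rep_inv pi w -> pi (mean ^+ n) w = w.
Proof.
by move=> hw; elim: n => [|n IH]; rewrite ?expr0 ?rep1// exprS repM IH mean_inv.
Qed.

Lemma nrm_pow n v : nrm (pi (mean ^+ n) v) <= nrm v.
Proof.
elim: n v => [|n IH] v; first by rewrite expr0 rep1.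
by rewrite exprS repM (le_trans (nrm_mean _)).
Qed.

(** Either an invariant vector within [nrm v / 2] is kept by the average, or the class of [v] has
    norm at least [nrm v / 2]. Then the gap and [pt_generated] give a [sigma i] that moves [v]
    noticeably, and convexity applied to [pi (sigma i) v] and [v] shortens the average. *)
Lemma mean_step v : BB B ->
  exists2 w, rep_inv pi w & nrm (pi mean v - w) <= rate * nrm v.
Proof.
move=> hB.
have [[w hw vw]|far] := pselect (exists2 w, rep_inv pi w & nrm (v - w) <= nrm v / 2).
  exists w => //; rewrite -(mean_inv hw) -linearB/= (le_trans (nrm_mean _))//.
  rewrite (le_trans vw)// mulrC ler_wpM2r ?nrm_ge0// /rate le_max.
  by apply/orP; left; lra.
have {}far w : rep_inv pi w -> nrm v / 2 < nrm (v - w).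
  by move=> hw; rewrite ltNge; apply/negP => vw; apply: far; exists w.
have v0 : 0 < nrm v.
  by have := far 0 (rep_inv0 pi); rewrite subr0; lra.
set q := quot_nrm (rep_inv pi) v.
have vq : nrm v / 2 <= q by apply: quot_nrm_ge => w /far/ltW.
have q0 : 0 < q by lra.
have [c' cc' /(_ (q^-1%:C%C *: v))] := gap hB pi.
rewrite quot_nrmZ ?invr_gt0// mulVf ?gt_eqF// => /(_ erefl)[V [ptV VE]].
have -> : pi V (q^-1%:C%C *: v) - pi (chi (pt_range V)) (q^-1%:C%C *: v) =
    q^-1%:C%C *: pi (V - chi (pt_range V)) v.
  by rewrite -repB linearZ.
move=> /le_trans/(_ (quot_nrm_le _ (rep_inv0 pi))).
rewrite subr0 nrmZr gtr0_norm ?invr_gt0// ler_pdivlMl// => big.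
have [C VC] := pt_generated hs s_cover i0 ptV VE.
have {}big : c * (nrm v / 2) <= \sum_i nrm (pi (sigma i) v - v).
  apply: (@le_trans _ _ (q * c')).
    by rewrite mulrC ler_pM// ?ltW//; lra.
  rewrite (le_trans big)// VC rep_sum (le_trans (nrm_sum _ _))//.
  apply: ler_sum => i _; rewrite repM (le_trans (nrm_partial_translation _ _ (pt_chi _)))//.
  by rewrite repB rep1.
have [i hi] : exists i, t * nrm v <= nrm (pi (sigma i) v - v).
  apply: contrapT => /forallNP small.
  have : \sum_i nrm (pi (sigma i) v - v) <= \sum_(i : I) t * nrm v.
    by apply: ler_sum => i _; rewrite leNgt; apply/negP => /ltW/small.
  apply/negP; rewrite -ltNge sumr_const -[_ *+ #|I|]mulr_natl (lt_le_trans _ big)//.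
  have Nt : N * t <= c / 4.
    by rewrite mulrC -ler_pdivlMr// -mulrA -invfM /t ge_min lexx.
  rewrite -/N mulrA (@le_lt_trans _ _ (c / 4 * nrm v)) ?ler_wpM2r ?nrm_ge0//.
  have := mulr_gt0 c_gt0 v0; lra.
have ne : i != i0.
  apply/eqP => ii0; move: hi; rewrite ii0 sigma_i0 subrr nrm0.
  by apply/negP; rewrite -ltNge mulr_gt0//; case/andP: t02.
(* In the second case the average itself is short, so no invariant part has to be removed. *)
exists 0; first exact: rep_inv0.
rewrite subr0 meanE nrmZr gtr0_norm ?invr_gt0// ler_pdivrMl//.
have : nrm (pi (sigma i) v + v) <= 2 * (1 - d t) * nrm v.
  apply: (uniformly_convex_scaled (dBB hB) t02) => //; [exact: nrm_ge0|exact: nrm_sigma].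
move=> conv.
rewrite (bigD1 i)//= (bigD1 i0) 1?eq_sym//= addrA sigma_i0.
rewrite (le_trans (nrmD _ _))//.
have rest : nrm (\sum_(j | (j != i) && (j != i0)) pi (sigma j) v) <= (N - 2) * nrm v.
  rewrite -big_filter (le_trans (nrm_sum _ _))// big_filter.
  under eq_bigr do rewrite nrm_sigma.
  have : \sum_(j : I) nrm v = N * nrm v by rewrite sumr_const -mulr_natl.
  rewrite (bigD1 i)//= (bigD1 i0) 1?eq_sym//= => h.
  have -> : \sum_(j | (j != i) && (j != i0)) nrm v = N * nrm v - nrm v - nrm v.
    by rewrite -h; lra.
  by lra.
rewrite (le_trans (lerD conv rest))//.
rewrite -mulrDl mulrA ler_wpM2r ?nrm_ge0//.
rewrite (@le_trans _ _ (N * (1 - 2 * d t / N)))//.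
  by rewrite [leRHS]mulrBr mulr1 [N * _]mulrC mulfVK ?gt_eqF//; lra.
by rewrite ler_pM2l// /rate le_max lexx orbT.
Qed.

Lemma pow_step n v : BB B ->
  exists2 w, rep_inv pi w & nrm (pi (mean ^+ n) v - w) <= rate ^+ n * nrm v.
Proof.
move=> hB; elim: n => [|n [w hw vw]].
  by exists 0; [exact: rep_inv0|rewrite subr0 rep1 expr0 mul1r].
have [w' hw' h] := mean_step (pi (mean ^+ n) v - w) hB.
exists (w + w'); first exact: rep_invD.
rewrite exprS repM opprD addrA -{1}(mean_inv hw) -linearB/= (le_trans h)//.
have /andP[r0 _] := rate01.
by rewrite exprS -mulrA ler_wpM2l.
Qed.

(** The invariant vector close to the [n]-th iterate is fixed by further averaging and cancels; the
    bound does not depend on the representation. *)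
Lemma mean_pow_near m n v : BB B ->
  nrm (pi (mean ^+ (m + n)) v - pi (mean ^+ n) v) <= 2 * rate ^+ n * nrm v.
Proof.
move=> /(pow_step n v)[w hw vw]; set u := pi (mean ^+ n) v in vw *.
have -> : pi (mean ^+ (m + n)) v - u = pi (mean ^+ m) (u - w) - (u - w).
  by rewrite exprD repM (linearB (pi (mean ^+ m))) (pow_inv m hw) opprB addrA subrK.
rewrite (le_trans (nrmD _ _))// nrmN.
have := nrm_pow m (u - w); lra.
Qed.

End OneRepresentation.

Let mean_pow_maxnorm m n :
  maxnorm BB (mean ^+ (m + n) - mean ^+ n) <= 2 * rate ^+ n.
Proof.
have /andP[r0 _] := rate01.
apply: maxnorm_le => [|B hB pi]; first by rewrite mulr_ge0// exprn_ge0.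
apply: opnorm_le => [|v v1]; first exact: rep_continuous.
rewrite repB (le_trans (mean_pow_near pi m n v hB))// ler_piMr// mulr_ge0//.
exact: exprn_ge0.
Qed.

Let mean_pow_near_eps (e : R) : 0 < e ->
  exists n0, forall m n, (n0 <= m)%N -> (n0 <= n)%N ->
    maxnorm BB (mean ^+ m - mean ^+ n) < e.
Proof.
move=> e0; have [n0 h] := expr_lt_eps rate01 (divr_gt0 e0 (ltr0n R 2)).
exists n0 => m n n0m n0n; wlog nm : m n n0m n0n / (n <= m)%N.
  by move=> wl; have [/wl->//|/ltnW/wl h'] := leqP n m; rewrite -maxnormN opprB h'.
rewrite -(subnK nm) (le_lt_trans (mean_pow_maxnorm _ _))//.
by rewrite mulrC -ltr_pdivlMr// h.
Qed.

Let mean_pow_cauchy : (fun n => mean ^+ n) \in cauchy_pred (maxseminorm BB X).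
Proof. by apply/cauchy_predP => e /mean_pow_near_eps. Qed.

Let mean_pows := CauchySeq mean_pow_cauchy.

Let p : C_max BB X := cpl_class mean_pows.

Let p_idempotent : p * p = p.
Proof.
rewrite -[LHS]/(cpl_mul p p) cpl_mulE; apply/cpl_classE => e /mean_pow_near_eps[n0 h].
exists n0 => n n0n.
rewrite -[X in X < _]/(maxnorm BB (mean ^+ n * mean ^+ n - mean ^+ n)) -exprD.
by apply: h => //; rewrite (leq_trans n0n)// leq_addr.
Qed.

Section LimitProjection.
Context {B : completeNormedModType R[i]}.
Hypothesis hB : BB B.
Variable pi : representation X B.
Implicit Types (v w : B).

Variable P : {linear B -> B}.
Hypothesis PE : rep_ext pi p = P.

Let P_cvg v : pi (mean ^+ n) v @[n --> \oo] --> P v.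
Proof. rewrite -PE; exact: (@rep_ext_class _ BB X B pi mean_pows v hB). Qed.

Let P_nrm v : nrm (P v) <= 1 * nrm v.
Proof.
by rewrite mul1r; apply: (nrm_cvg_le (@P_cvg v)); exists 0%N => n _; exact: nrm_pow.
Qed.

Let P_inv v : rep_inv pi (P v).
Proof.
apply: rep_inv_closed => e e0.
have v1 : 0 < nrm v + 1 by rewrite ltr_wpDl// nrm_ge0.
have [n1 h1] := (nrm_cvgP _ _).1 (@P_cvg v) _ (divr_gt0 e0 (ltr0n R 2)).
have [n2 h2] := expr_lt_eps rate01 (divr_gt0 (divr_gt0 e0 (ltr0n R 2)) v1).
pose n := maxn n1 n2.
have [w hw vw] := pow_step pi n v hB; exists w => //.
rewrite -[P v](subrK (pi (mean ^+ n) v)) -addrA (le_trans (nrmD _ _))//.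
rewrite [leRHS]splitr; apply: lerD.
  by rewrite nrmB; apply/ltW/h1; exact: leq_maxl.
apply: ltW; apply: (le_lt_trans vw).
have := h2 n (leq_maxr _ _); rewrite ltr_pdivlMr//; apply: le_lt_trans.
have /andP[r0 _] := rate01.
by rewrite ler_wpM2l ?exprn_ge0// lerDl.
Qed.

Let P_fix w : rep_inv pi w -> P w = w.
Proof.
move=> hw; apply: nrm_cvg_unique (@P_cvg w) _.
by under eq_fun do rewrite pow_inv//; exact: cvg_cst.
Qed.

Let P_mean v : P (pi mean v) = P v.
Proof.
apply: nrm_cvg_unique (@P_cvg (pi mean v)) _.
apply/nrm_cvgP => e e0; have [n0 h] := (nrm_cvgP _ _).1 (@P_cvg v) e e0.
exists n0 => n n0n; rewrite -repM -exprSr; apply: h; exact: leqW.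
Qed.

(** The drift argument upgrades [P_mean] from the average to each [sigma i], by comparison with the
    identity [sigma i0]. *)
Let P_sigma i v : P (pi (sigma i) v) = P v.
Proof.
rewrite -[in RHS](sigma_i0 pi v).
apply: (stationary_invariant d_gt0 (dBB hB) (g := fun i => pi (sigma i))
  (h := fun i => pi (sigma i)) i i0 v (@P_nrm)) => {v}.
- exact: sigmaK.
- exact: sigmaK.
- exact: nrm_sigma.
- move=> v; rewrite -linear_sum -[in RHS]P_mean meanE linearZ/= scalerA.
  rewrite -(rmorph_nat (real_complex R)) -rmorphM/= mulfV ?gt_eqF//.
  by rewrite scale1r.
Qed.

(** Matrices killed by [P] on the left form a right ideal; adjoints make it a left one, and also
    match the definition of the dual representation. *)
Let P_left_ideal : left_ideal [set T | forall v, P (pi (Cu_adj T) v) = 0].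
Proof.
split=> [v|S T /= hS hT v|S T /= hT v].
- suff -> : Cu_adj 0 = 0 :> Cu X by rewrite rep0 linear0.
  by apply: Cu_ext => x y; exact: rmorph0.
- by rewrite Cu_adjD repD linearD/= hS hT addr0.
- by rewrite Cu_adjM repM hT.
Qed.

Let P_adj V v : partial_translation V ->
  P (pi (Cu_adj V) v) = P (pi (Cu_adj (chi (pt_range V))) v).
Proof.
move=> ptV; apply/eqP; rewrite -subr_eq0 -linearB/= -repB -Cu_adjN -Cu_adjD; apply/eqP.
apply: (pt_left_ideal sK s_cover i0 E_generating P_left_ideal) => //.
move=> i u /=; rewrite Cu_adjD Cu_adjN translation_adj//.
have -> : Cu_adj 1 = 1 :> Cu X by rewrite -chiT chi_adj.
by rewrite repB rep1 linearB/= P_sigma subrr.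
Qed.

(** An invariant functional is unchanged by each [sigma i], hence by the powers of the average, and
    by continuity in the limit. *)
Let dual_inv_P f v : dual_inv pi f -> f (P v) = f v.
Proof.
move=> [[flin fcont] finv].
have fs i u : f (pi (sigma i) u) = f u.
  have := congr1 (fun g => g u) (finv (sigma i) (pt_sigma i)).
  rewrite /dual_rep translation_adj// pt_range_translation// chiT.
  have -> : Cu_adj 1 = 1 :> Cu X by rewrite -chiT chi_adj.
  by rewrite rep1.
pose F : {linear B -> R[i]^o} := HB.pack f (GRing.isLinear.Build _ _ _ *:%R _ flin).
have fmean u : f (pi mean u) = f u.
  rewrite -[f]/(F : B -> _) meanE linearZ linear_sum/=.
  under eq_bigr do rewrite fs.
  rewrite sumr_const -scaler_nat scalerA -(rmorph_nat (real_complex R)) -rmorphM/=.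
  by rewrite mulVf ?gt_eqF// scale1r.
have fpow n u : f (pi (mean ^+ n) u) = f u.
  by elim: n => [|n IH]; rewrite ?expr0 ?rep1// exprS repM fmean.
have c1 : (f (pi (mean ^+ n) v) : R[i]^o) @[n --> \oo] --> (f (P v) : R[i]^o).
  exact: (continuous_cvg _ (fcont (P v)) (@P_cvg v)).
have c2 : (f (pi (mean ^+ n) v) : R[i]^o) @[n --> \oo] --> (f v : R[i]^o).
  by under eq_fun do rewrite fpow; exact: cvg_cst.
exact: (nrm_cvg_unique (V := R[i]^o) c1 c2).
Qed.

Lemma limit_projection : idempotent_onto_along (rep_ext pi p) (rep_inv pi) (rep_ann pi).
Proof.
rewrite PE; split.
- by apply/funext => v /=; rewrite P_fix.
- apply/seteqP; split=> [_ [v _ <-]//|w hw].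
  by exists w => //; exact: P_fix.
- apply/seteqP; split=> [v /= Pv f hf|v hv].
    have [[flin _] _] := hf.
    rewrite -dual_inv_P// Pv.
    by have := flin (-1) 0 0; rewrite scaler0 addr0 scaleN1r addNr.
  apply/eqP; apply: contraT => Pv0.
  have [g [glin gcont] gPv] := dual_separates_points Pv0.
  (* By [P_adj], composing a continuous functional with [P] makes it invariant, so it must vanish at
     [v]. *)
  case/eqP: gPv; apply: (hv (fun u => g (P u))).
  split; first split.
  + by move=> a x y; rewrite linearP glin.
  + move=> x; apply: continuous_comp; last exact: gcont.
    exact: nrm_le_continuous P_nrm x.
  + by move=> V ptV; apply/funext => u; rewrite /dual_rep P_adj.
Qed.

End LimitProjection.

Lemma spectral_gap_projection : exists q : C_max BB X, q * q = q /\
  forall B, BB B -> forall pi : representation X B,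
    idempotent_onto_along (rep_ext pi q) (rep_inv pi) (rep_ann pi).
Proof.
exists p; split=> // B hB pi.
pose P : {linear B -> B} :=
  HB.pack (rep_ext pi p) (GRing.isLinear.Build _ _ _ *:%R _ (rep_ext_linear p pi hB)).
exact: (@limit_projection B hB pi P erefl).
Qed.

End SpectralGapProjection.

(** * Representations on ultraproducts *)

Section UltraproductRepresentation.
Context {R : realType} {X : bgSpace R}.
Variables (omega : set_system nat) (Bs : nat -> completeNormedModType R[i]).
Variables (U : completeNormedModType R[i]) (q : (forall n, Bs n) -> U).
Context {omegaF : ProperFilter omega}.
Hypothesis qU : is_ultraproduct omega q.
Variable pis : forall n, representation X (Bs n).
Implicit Types (v w : forall n, Bs n) (T : Cu X).

Lemma ultraproduct_le v w (c : R) : bounded_sequence v -> bounded_sequence w ->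
  (forall n, nrm (v n) <= c * nrm (w n)) -> nrm (q v) <= c * nrm (q w).
Proof.
move=> bv bw h; have [_ _ qn] := qU.
have h1 := qn v bv; have h2 : c * nrm (w n) @[n --> omega] --> c * nrm (q w).
  by apply: cvgMr; exact: qn.
by apply: (ler_cvg_to h1 h2); apply: nearW.
Qed.

Lemma ultraproduct_le_cst v (c : R) : bounded_sequence v ->
  (forall n, nrm (v n) <= c) -> nrm (q v) <= c.
Proof.
move=> bv h; have [_ _ qn] := qU.
by apply: (ler_cvg_to (qn v bv) (cvg_cst c)); apply: nearW.
Qed.

Lemma ultraproduct_ge_cst v (c : R) : bounded_sequence v ->
  (forall n, c <= nrm (v n)) -> c <= nrm (q v).
Proof.
move=> bv h; have [_ _ qn] := qU.
by apply: (ler_cvg_to (cvg_cst c) (qn v bv)); apply: nearW.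
Qed.

Lemma bounded_comb a v w : bounded_sequence v -> bounded_sequence w ->
  bounded_sequence (fun n => a *: v n + w n).
Proof.
move=> [M hM] [K hK]; exists (nrm a * M + K) => n.
rewrite (le_trans (nrmD _ _))//; apply: lerD; last exact: hK.
by rewrite nrmZ; apply: ler_wpM2l; [exact: nrm_ge0|exact: hM].
Qed.

Lemma bounded_rep T v : bounded_sequence v -> bounded_sequence (fun n => pis n T (v n)).
Proof.
move=> [M hM]; exists (l1norm T * M) => n.
rewrite (le_trans (nrm_rep_l1norm _ _ _))//; apply: ler_wpM2l; last exact: hM.
by rewrite (le_trans _ (rep_l1norm (pis 0) T))// opnorm_ge0//; exact: rep_continuous.
Qed.

Lemma ultraproduct_sub v w : bounded_sequence v -> bounded_sequence w ->
  q (fun n => v n - w n) = q v - q w.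
Proof.
move=> bv bw; have [ql _ _] := qU.
have := ql (-1) w v bw bv; rewrite scaleN1r addrC => <-; congr q.
by apply: functional_extensionality_dep => n; rewrite scaleN1r addrC.
Qed.

Lemma bounded_sub v w : bounded_sequence v -> bounded_sequence w ->
  bounded_sequence (fun n => v n - w n).
Proof.
move=> [M hM] [K hK]; exists (M + K) => n.
rewrite (le_trans (nrmD _ _))// nrmN; apply: lerD; [exact: hM|exact: hK].
Qed.

(** [l1norm T] bounds all the operators [pis n T] at once, so the class of the image depends only on
    the class of the sequence. *)
Lemma ultraproduct_rep_well_defined T v w : bounded_sequence v -> bounded_sequence w ->
  q v = q w -> q (fun n => pis n T (v n)) = q (fun n => pis n T (w n)).
Proof.
move=> bv bw vw; apply/eqP; rewrite -subr_eq0 -ultraproduct_sub; last 2 first.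
- exact: bounded_rep.
- exact: bounded_rep.
apply/eqP/nrm_eq0/eqP; rewrite eq_le nrm_ge0 andbT.
have -> : 0 = l1norm T * nrm (q (fun n => v n - w n)).
  by rewrite ultraproduct_sub// vw subrr nrm0 mulr0.
apply: ultraproduct_le => [||n]; last by rewrite -linearB nrm_rep_l1norm.
  by apply: bounded_sub; exact: bounded_rep.
exact: bounded_sub.
Qed.

Lemma ultraproduct_representation : exists piU : representation X U,
  forall T v, bounded_sequence v -> piU T (q v) = q (fun n => pis n T (v n)).
Proof.
have [ql qs _] := qU.
have [u|r hr] := @choice _ _ (fun u v => bounded_sequence v /\ q v = u).
  by have [v bv <-] := qs u; exists v.
pose op T u := q (fun n => pis n T (r u n)).
have opE T v : bounded_sequence v -> op T (q v) = q (fun n => pis n T (v n)).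
  move=> bv; have [br qr] := hr (q v).
  exact: ultraproduct_rep_well_defined.
have op_lin T : linear (op T).
  move=> a u u'; have [bv <-] := hr u; have [bv' <-] := hr u'.
  rewrite -ql// !opE//; last exact: bounded_comb.
  rewrite -ql; [|exact: bounded_rep|exact: bounded_rep]; congr q.
  by apply: functional_extensionality_dep => n; rewrite linearP.
pose opL T : {linear U -> U} :=
  HB.pack (op T) (GRing.isLinear.Build _ _ _ *:%R _ (op_lin T)).
have op_le T u : nrm (opL T u) <= l1norm T * nrm u.
  have [bv <-] := hr u; rewrite [opL T _]opE//.
  by apply: ultraproduct_le => [||n]; [exact: bounded_rep| |exact: nrm_rep_l1norm].
have l1_ge0 T : 0 <= l1norm T.
  by rewrite (le_trans _ (rep_l1norm (pis 0) T))// opnorm_ge0//; exact: rep_continuous.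
have contL T : continuous (opL T) by exact: nrm_le_continuous (op_le T).
have opLE T v : bounded_sequence v -> opL T (q v) = q (fun n => pis n T (v n)) := @opE T v.
have addL S T u : opL (S + T) u = opL S u + opL T u.
  have [bv <-] := hr u; rewrite !opLE//.
  have := ql 1 _ _ (@bounded_rep S _ bv) (@bounded_rep T _ bv); rewrite scale1r => <-.
  by congr q; apply: functional_extensionality_dep => n; rewrite repD scale1r.
have b0 : bounded_sequence (fun n => 0 : Bs n) by exists 0 => n; rewrite nrm0.
have q0 : q (fun=> 0) = 0.
  rewrite -[RHS](subrr (q (fun=> 0))) -ultraproduct_sub//; congr q.
  by apply: functional_extensionality_dep => n; rewrite subrr.
have scaleL a T u : opL (a *: T) u = a *: opL T u.
  have [bv <-] := hr u; rewrite !opLE//.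
  have := ql a _ _ (@bounded_rep T _ bv) b0; rewrite q0 addr0 => <-.
  by congr q; apply: functional_extensionality_dep => n; rewrite repZ addr0.
have mulL S T u : opL (S * T) u = opL S (opL T u).
  have [bv <-] := hr u; rewrite !opLE//; last exact: bounded_rep.
  by congr q; apply: functional_extensionality_dep => n; rewrite repM.
have oneL u : opL 1 u = u.
  have [bv e] := hr u; rewrite -[RHS]e -[in LHS]e opLE//.
  by congr q; apply: functional_extensionality_dep => n; rewrite rep1.
have l1L T : opnorm (opL T) <= l1norm T.
  by apply: opnorm_le => // u u1; rewrite (le_trans (op_le T u))// ler_piMr.
by exists (Representation contL addL scaleL mulL oneL l1L) => T v; exact: opLE.
Qed.

End UltraproductRepresentation.

(** * From the idempotent to the spectral gap *)

Section ProjectionSpectralGap.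
Context {R : realType}.
Variables (BB : completeNormedModType R[i] -> Prop) (X : bgSpace R).
Variables (E : set (X * X)) (I : finType) (s : I -> X -> X) (A : I -> set X) (i0 : I).
Hypothesis BB_ultra : closed_under_ultraproducts BB.
Hypothesis E_generating : generating E.
Hypothesis hs : forall i, bounded_displacement (s i).
Hypothesis sK : forall i, involutive (s i).
Hypothesis s_moved : forall i x, s i x <> x -> E (x, s i x) /\ (A i x <-> ~ A i (s i x)).
Hypothesis s_cover : forall x y, E (x, y) -> exists i, s i x = y.
Variable p : C_max BB X.
Hypothesis p_proj : forall B, BB B -> forall pi : representation X B,
  idempotent_onto_along (rep_ext pi p) (rep_inv pi) (rep_ann pi).

Let sigma i : Cu X := translation (hs i).

(** Failure of the gap at [2 * c] gives [v0] with class of norm 1. A representative of norm below 2,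
    minus its image under the idempotent, is bounded by [2 * (1 + K)]; the invariant vectors
    subtracted do not affect the displacement classes. *)
Lemma almost_invariant_vector (K : R) :
  (forall B (pi : representation X B) v, BB B -> nrm (rep_ext pi p v) <= K * nrm v) ->
  0 <= K ->
  forall B (pi : representation X B) (c : R), BB B -> 0 < c -> ~ has_spectral_gap pi E c ->
  exists v : B, [/\ rep_ext pi p v = 0, nrm v <= 2 * (1 + K), 1 <= nrm v &
    forall V, partial_translation V -> supp V `<=` E ->
      exists2 w, rep_inv pi w & nrm (pi (V - chi (pt_range V)) v - w) < 2 * c].
Proof.
move=> hK K0 B pi c hB c0 nogap.
have [v0 [q1 small]] : exists v, quot_nrm (rep_inv pi) v = 1 /\
    forall V, partial_translation V -> supp V `<=` E ->
      quot_nrm (rep_inv pi) (pi V v - pi (chi (pt_range V)) v) < 2 * c.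
  apply: contrapT => /forallNP h; apply: nogap; exists (2 * c); first by lra.
  move=> v q1; apply: contrapT => /forallNP h'; apply: (h v); split=> // V ptV VE.
  by rewrite ltNge; apply/negP => big; apply: (h' V).
have [w0 hw0 v0w0] : exists2 w, rep_inv pi w & nrm (v0 - w) < 2.
  by apply: quot_nrm_lt; rewrite q1; lra.
have [idem rangeP _] := p_proj hB pi.
have P_lin := rep_ext_linear p pi hB.
pose P : {linear B -> B} := HB.pack (rep_ext pi p) (GRing.isLinear.Build _ _ _ *:%R _ P_lin).
have P_inv u : rep_inv pi (P u) by rewrite -rangeP; exists u.
have hy : rep_inv pi (w0 + P (v0 - w0)) by exact: rep_invD.
exists (v0 - w0 - P (v0 - w0)); split.
- rewrite -[LHS]/(P (v0 - w0 - P (v0 - w0))) linearB/=.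
  by rewrite -[X in _ - X]/((rep_ext pi p \o rep_ext pi p) (v0 - w0)) idem subrr.
- rewrite (le_trans (nrmD _ _))// nrmN.
  have := hK B pi (v0 - w0) hB; rewrite -[rep_ext _ _ _]/(P (v0 - w0)).
  have := nrm_ge0 (v0 - w0); nra.
- by rewrite -q1 -addrA -opprD; exact: quot_nrm_le.
- move=> V ptV VE; apply: quot_nrm_lt.
  rewrite -addrA -opprD linearB/= repB.
  have -> : pi (V - chi (pt_range V)) (w0 + P (v0 - w0)) = 0.
    by rewrite repB (hy V ptV) subrr.
  by rewrite subr0; exact: small.
Qed.

Section Limit.
Variables (U : completeNormedModType R[i]) (pi : representation X U) (v : U).
Hypothesis v_inv : forall V, partial_translation V -> supp V `<=` E ->
  rep_inv pi (pi (V - chi (pt_range V)) v).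

(** The displacement [w] of [v] is invariant and fixed by [chi D], while [V * chi D] is 0 because
    [s i] leaves [D]. Hence [w] equals [pi V w], which is 0. *)
Let half_fixed i (D : set X) : (forall x, D x -> s i x <> x) ->
  (forall x, D x -> ~ D (s i x)) -> pi (chi D * (sigma i - 1)) v = 0.
Proof.
move=> Dmoved Ddisj; pose V := chi D * sigma i.
have ptV : partial_translation V by apply: pt_chi_mul; exact: pt_translation.
have RV : pt_range V = D by rewrite pt_range_chi_mul pt_range_translation setIT.
have VE : supp V `<=` E.
  move=> [x y] Vxy; have {Vxy} : V x y != 0 by exact: Vxy.
  rewrite chi_mull translationE; case: ifP => [/set_mem Dx|_ /eqP//].
  by case: (s i x =P y) => [<- _|_ /eqP//]; exact: (s_moved (Dmoved x Dx)).1.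
have eV : V - chi (pt_range V) = chi D * (sigma i - 1) by rewrite RV mulrBr mulr1.
have chiK : chi D * chi D = chi D :> Cu X.
  by apply: Cu_ext => x y; rewrite chi_mull chiE /indicator; case: (x \in D); case: eqP.
have VD : V * chi D = 0.
  apply: Cu_ext => x y; rewrite /V -mulrA chi_mull translation_mull chiE /indicator.
  case: ifP => [/set_mem/Ddisj nD|//]; rewrite memNset//.
  by case: eqP.
pose w := pi (V - chi (pt_range V)) v.
have wE : pi (chi D) w = w by rewrite /w eV -repM mulrA chiK.
have : pi V w = pi (chi (pt_range V)) w by have := v_inv ptV VE; apply.
by rewrite RV wE -[X in pi V X]wE -repM VD rep0 /w eV => <-.
Qed.

Lemma limit_invariant : rep_inv pi v.
Proof.
move=> V ptV; apply/eqP; rewrite -subr_eq0 -repB; apply/eqP.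
apply: (pt_left_ideal (hs := hs) sK s_cover i0 E_generating
  (rep_annihilator_left_ideal pi v)) => // i.
(* [A i] splits the moved points into two halves that [s i] exchanges, and [half_fixed] applies to
   each. *)
pose D := [set x | s i x <> x /\ A i x]; pose D' := [set x | s i x <> x /\ ~ A i x].
have -> : translation (hs i) - 1 = chi D * (sigma i - 1) + chi D' * (sigma i - 1).
  apply: Cu_ext => x y.
  rewrite -[RHS]/((chi D * (sigma i - 1)) x y + (chi D' * (sigma i - 1)) x y) !chi_mull.
  have [sx|sx] := pselect (s i x = x).
    rewrite !memNset => [|[]//|[]//]; rewrite addr0.
    by rewrite -[LHS]/(translation (hs i) x y - (1 : Cu X) x y) translationE sx Cu_oneE subrr.
  have [Ax|nAx] := pselect (A i x).
    by rewrite mem_set// memNset ?addr0// => -[].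
  by rewrite memNset ?mem_set ?add0r// => -[].
rewrite /= repD !half_fixed ?addr0//.
- by move=> x [].
- by move=> x [sx nA] [_]; have [_ h] := s_moved sx; move=> nA'; apply: nA; apply/h.
- by move=> x [].
- by move=> x [sx Ax] [_]; have [_ h] := s_moved sx; exact: h.1.
Qed.

End Limit.

Lemma projection_spectral_gap : exists2 c : R, 0 < c &
  forall B, BB B -> forall pi : representation X B, has_spectral_gap pi E c.
Proof.
apply: contrapT => nogap.
have [K K0 hK] := rep_ext_bounded p.
(* Space, representation and vector are bundled so that one choice picks all three for every [n]. *)
pose D := {B : completeNormedModType R[i] & (representation X B * B)%type}.
pose good (n : nat) (x : D) := let: existT B (pi, v) := x in
  BB B /\ [/\ rep_ext pi p v = 0, nrm v <= 2 * (1 + K), 1 <= nrm v &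
    forall V, partial_translation V -> supp V `<=` E ->
      exists2 w, rep_inv pi w & nrm (pi (V - chi (pt_range V)) v - w) < 2 * n.+1%:R^-1].
have [n|x hx] := @choice _ _ good.
  apply: contrapT => h; apply: nogap; exists n.+1%:R^-1; first by rewrite invr_gt0.
  move=> B hB pi; apply: contrapT => ng.
  have n0 : 0 < n.+1%:R^-1 :> R by rewrite invr_gt0.
  have [v hv] := almost_invariant_vector hK K0 hB n0 ng.
  by apply: h; exists (existT _ B (pi, v)).
pose Bs n := projT1 (x n); pose pis n : representation X (Bs n) := (projT2 (x n)).1.
pose v n : Bs n := (projT2 (x n)).2.
have {}hx n : BB (Bs n) /\ [/\ rep_ext (pis n) p (v n) = 0, nrm (v n) <= 2 * (1 + K),
    1 <= nrm (v n) & forall V, partial_translation V -> supp V `<=` E ->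
      exists2 w, rep_inv (pis n) w &
        nrm (pis n (V - chi (pt_range V)) (v n) - w) < 2 * n.+1%:R^-1].
  by have := hx n; rewrite /good /Bs /pis /v; case: (x n) => B [].
have [omega [omegaU omegaoo]] := ultraFilterLemma (F := \oo) _.
have omega_np : nonprincipal omega.
  move=> n hn; have : omega [set k | (n < k)%N] by apply: omegaoo; exists n.+1.
  by move=> /(filterI hn)/filter_ex[k [/= -> ]]; rewrite ltnn.
have [U [q [qU hU]]] := BB_ultra (fun n => (hx n).1) omegaU omega_np.
have [piU piUE] := ultraproduct_representation qU pis.
have bv : bounded_sequence v by exists (2 * (1 + K)) => n; have [_ []] := hx n.
have inv_eta : rep_inv piU (q v).
  apply: limit_invariant => V ptV VE.
  have {hx} hx n := (hx n).2.
  have wP n : {w | rep_inv (pis n) w &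
      nrm (pis n (V - chi (pt_range V)) (v n) - w) < 2 * n.+1%:R^-1}.
    by apply: cid2; have [_ _ _ h] := hx n; exact: h.
  pose w n : Bs n := s2val (wP n).
  have w_inv n : rep_inv (pis n) (w n) := s2valP (wP n).
  have w_near n : nrm (pis n (V - chi (pt_range V)) (v n) - w n) < 2 * n.+1%:R^-1.
    exact: s2valP' (wP n).
  have bVv : bounded_sequence (fun n => pis n (V - chi (pt_range V)) (v n)).
    exact: bounded_rep.
  have bw : bounded_sequence w.
    have [M hM] := bVv; exists (2 + M) => n.
    rewrite -[w n](subrK (pis n (V - chi (pt_range V)) (v n))).
    rewrite (le_trans (nrmD _ _))//; apply: lerD; last exact: hM.
    rewrite nrmB (le_trans (ltW (w_near n)))// ler_piMr// invf_le1// ler1n//.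
  (* The two sequences differ by less than [2 * n.+1%:R^-1] in norm, which tends to 0 along
     [omega]. *)
  have -> : piU (V - chi (pt_range V)) (q v) = q w.
    rewrite piUE//; apply/eqP; rewrite -subr_eq0 -(ultraproduct_sub qU)//.
    apply/eqP/nrm_eq0.
    have [_ _ qn] := qU.
    have h1 := qn _ (bounded_sub bVv bw).
    apply: (cvg_unique _ h1) => //.
    apply/cvgrPdist_le => e e0.
    have [n0 hn0] : exists n0 : nat, 2 * e^-1 <= n0%:R.
      by exists (Num.truncn (2 * e^-1)).+1; rewrite ltW// truncnS_gt.
    apply: omegaoo; exists n0 => // n /= n0n.
    rewrite sub0r normrN ger0_norm ?nrm_ge0// (le_trans (ltW (w_near n)))//.
    rewrite ler_pdivrMr// mulrC -ler_pdivrMr// (le_trans hn0)// ler_nat.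
    exact: leqW.
  move=> W ptW; rewrite !piUE//; congr q.
  by apply: functional_extensionality_dep => n; exact: w_inv.
have [idem rangeP _] := p_proj hU piU.
have Peta : rep_ext piU p (q v) = q v.
  have : range (rep_ext piU p) (q v) by rewrite rangeP.
  by move=> [y _ <-]; rewrite -[LHS]/((rep_ext piU p \o rep_ext piU p) y) idem.
have eta1 : 1 <= nrm (q v) by apply: (ultraproduct_ge_cst qU) => // n; have [_ []] := hx n.
have etaK : nrm (q v) <= 2 * (1 + K).
  by apply: (ultraproduct_le_cst qU) => // n; have [_ []] := hx n.
suff : q v = 0 by move=> e; move: eta1; rewrite e nrm0; lra.
rewrite -Peta; apply: nrm_le_eps_eq0 => e e0.
(* [piU] is computed termwise on matrices only, so [p] is replaced by a matrix [T]. With vectors of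
   norm at most [2 * (1 + K)], accuracy [e / (4 * (1 + K))] costs [e / 2] in the factors and again
   in the ultraproduct. *)
have K4 : 0 < 4 * (1 + K) by rewrite mulr_gt0//; lra.
have [u pE] : exists u, cpl_class u = p.
  by exists (repr (p : completion (maxseminorm BB X))); exact: reprK.
have [n0 /(_ _ (leqnn _))] := rep_ext_near u (divr_gt0 e0 K4); rewrite pE.
move=> near; set T := cs_seq u n0 in near.
have hT : nrm (piU T (q v)) <= e / 2.
  rewrite piUE//; apply: (ultraproduct_le_cst qU); first exact: bounded_rep.
  move=> n; have [hB [Pv vK _ _]] := hx n.
  have := near _ (pis n) (v n) hB; rewrite Pv subr0 => /le_trans; apply.
  rewrite mulrAC ler_pdivrMr// mulrC; nra.
rewrite -[rep_ext _ _ _](subrK (piU T (q v))) (le_trans (nrmD _ _))//.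
rewrite [leRHS]splitr lerD// nrmB (le_trans (near _ _ _ hU))//.
by rewrite mulrAC ler_pdivrMr//; nra.
Qed.

End ProjectionSpectralGap.

Theorem theorem1p3 (R : realType) (BB : completeNormedModType R[i] -> Prop)
  (BB_convex : uniformly_convex_family BB)
  (BB_ultra : closed_under_ultraproducts BB)
  (Y : nat -> extMetric R) (Y_finite : forall n, finite_set [set: Y n])
  (Y_bounded : bounded_geometry (disjUnion Y))
  (Y_monogenic : monogenic (disjUnion Y))
  (E0 : set (disjUnion Y * disjUnion Y))
  (E0_generating : generating E0) (E0_sym : rel_symmetric E0) :
  let X := BGSpace Y_bounded in
  uniform_geometric_property_T BB (X := X) E0 <->
  exists p : C_max BB X, p * p = p /\
    forall B : completeNormedModType R[i], BB B ->
    forall pi : representation X B,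
      idempotent_onto_along (rep_ext pi p) (rep_inv pi) (rep_ann pi).
Proof.
move=> X; have [[r E0r] _] := E0_generating.
have [I [s [A [sK s_moved s_cover [i0 s_i0]]]]] :=
  @involution_cover R X E0 E0_generating.1 E0_sym.
have hs i : @bounded_displacement R X (s i).
  (* The maximum with 0 covers fixed points, as [r] may be negative. *)
  exists (Num.max r 0) => x; have [->|/s_moved[Ex _]] := pselect (s i x = x).
    by rewrite ((Defs.edist_eq0 x x).2 erefl) lee_fin le_max lexx orbT.
  by apply: (le_trans (E0r _ Ex)); rewrite lee_fin le_max lexx.
split=> [[c c0 gap]|[p [_ p_proj]]].
  have [d d_gt0 dBB] := uniformly_convex_familyP BB_convex.
  exact: (@spectral_gap_projection R BB X d d_gt0 dBB E0 I s i0
    E0_generating hs sK s_cover s_i0 c c0 gap).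
exact: (@projection_spectral_gap R BB X E0 I s A i0 BB_ultra E0_generating hs sK
  s_moved s_cover p p_proj).
Qed.
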